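(* Let $n \geq 4$ and $2 \leq k \leq n-2$. Then there exists an infinitely smooth function $g \in C(G(n,n-k))$ such that $R_{n-k}^*(g) \geq 1$ and $(I \circ R_k)^*(g) \geq 1$ as functions in $C(S^{n-1})$, but $g$ is not non-negative as a functional on $R_{n-k}(C(S^{n-1}))$; in other words, there exists a non-negative $h \in R_{n-k}(C(S^{n-1}))$ such that $$\int_{G(n,n-k)} g(E) h(E)\, d\eta_{n,n-k}(E) < 0.$$ Moreover, both $g$ and $h$ can be chosen to be invariant under the action of $O(n-1)$.
   Context: $G(n,m)$ is the Grassmann manifold of $m$-dimensional linear subspaces of $\mathbb{R}^n$ and $\eta_{n,m}$ its Haar (rotation-invariant) probability measure; $\sigma_n$ is the Haar probability measure on $S^{n-1}$. For $f\in C(S^{n-1})$ and $E\in G(n,m)$, $R_m(f)(E)=\int_{S^{n-1}\cap E} f\,d\sigma_E$, where $\sigma_E$ is the Haar probability measure on $S^{n-1}\cap E$; thus $R_m:C(S^{n-1})\to C(G(n,m))$, and $R_m(C(S^{n-1}))$ denotes its range. $I:C(G(n,k))\to C(G(n,n-k))$ is defined by $I(f)(E)=f(E^\perp)$ for $E\in G(n,n-k)$. For $g\in C(G(n,m))$ the dual transform $R_m^*(g)\in C(S^{n-1})$ is $$R_m^*(g)(\theta)=\int_{\theta\in E\in G(n,m)} g(E)\,d\nu_{m,\theta}(E),$$ where $\nu_{m,\theta}$ is the Haar probability measure on the homogeneous space $\{E\in G(n,m):\theta\in E\}$; equivalently $\int_{S^{n-1}} f\,R_m^*(g)\,d\sigma_n=\int_{G(n,m)}R_m(f)\,g\,d\eta_{n,m}$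 for all $f\in C(S^{n-1})$. Likewise, for $g\in C(G(n,n-k))$, $(I\circ R_k)^*(g)\in C(S^{n-1})$ is determined by $\int_{S^{n-1}} f\,(I\circ R_k)^*(g)\,d\sigma_n=\int_{G(n,n-k)}(I\circ R_k)(f)\,g\,d\eta_{n,n-k}$ for all $f\in C(S^{n-1})$, i.e. it equals $R_k^*$ applied to the function $E\mapsto g(E^\perp)$ on $G(n,k)$. $O(n-1)$ is identified with the subgroup of $O(n)$ fixing some point $\xi_0\in S^{n-1}$, acting naturally on $G(n,n-k)$. *)

(* Defs.v *)
From HB Require Import structures.
From mathcomp Require Import all_boot all_order all_algebra.
From mathcomp Require Import all_classical all_reals all_analysis.

Set Implicit Arguments.
Unset Strict Implicit.
Unset Printing Implicit Defensive.

Import Order.TTheory GRing.Theory Num.Theory.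
Import numFieldNormedType.Exports.

Local Open Scope classical_set_scope.
Local Open Scope ring_scope.

(* Vectors of R^n are row vectors, on which matrices act on the right.  The
   norm of 'rV[R]_n in the library is the sup norm, so that the Euclidean sphere
   has to be defined through the dot product. *)
Definition dotv (R : realType) (n : nat) (x y : 'rV[R]_n) : R :=
  \sum_(i < n) x 0 i * y 0 i.

Definition sphere (R : realType) (n : nat) : set 'rV[R]_n :=
  [set x | dotv x x = 1].
Arguments sphere : clear implicits.

Definition orthogonal_group (R : realType) (n : nat) : set 'M[R]_n :=
  [set u | u *m u^T = 1%:M].
Arguments orthogonal_group : clear implicits.

Definition stabilizer (R : realType) (n : nat) (x : 'rV[R]_n) : set 'M[R]_n :=
  [set u | orthogonal_group R n u /\ x *m u = x].

(* All linear subspaces of R^n, of whatever dimension: the disjoint union of the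
   Grassmann manifolds G(n, m), 0 <= m <= n. *)
Definition linsub (R : realType) (n : nat) : Type := {vspace 'rV[R]_n}.

HB.instance Definition _ (R : realType) (n : nat) := Choice.on (linsub R n).
HB.instance Definition _ (R : realType) (n : nat) :=
  isPointed.Build (linsub R n) (0%VS : {vspace 'rV[R]_n}).

Definition grassmannian (R : realType) (n m : nat) : set (linsub R n) :=
  [set E | \dim (E : {vspace 'rV[R]_n}) = m].
Arguments grassmannian : clear implicits.

Definition rowspan (R : realType) (n m : nat) (A : 'M[R]_(m, n)) : linsub R n :=
  <<[seq row i A | i <- enum 'I_m]>>%VS.

Lemma rowspan_grassmannian (R : realType) (n m : nat) (A : 'M[R]_(m, n)) :
  row_free A -> grassmannian R n m (rowspan A).
Proof.
move=> Afree; rewrite /grassmannian /= /rowspan.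
suff /eqP -> : free [seq row i A | i <- enum 'I_m].
  by rewrite size_map size_enum_ord.
have -> : [seq row i A | i <- enum 'I_m]
        = [tuple of mkseq (fun i => [seq row i A | i <- enum 'I_m]`_i) m].
  apply: (@eq_from_nth _ 0); first by rewrite size_map size_enum_ord size_mkseq.
  by move=> i; rewrite size_map size_enum_ord => im; rewrite nth_mkseq.
apply/freeP => c c0 i.
have : (\row_i c i) *m A = 0.
  rewrite mulmx_sum_row -[RHS]c0; apply: eq_bigr => j _.
  rewrite mxE /= nth_mkseq //.
  by rewrite (nth_map j) ?size_enum_ord // nth_ord_enum.
move/eqP; rewrite mulmx_free_eq0 // => /eqP/rowP/(_ i).
by rewrite !mxE.
Qed.

(* The quotient topology: G(n, m) is the quotient of the open set of m x n
   matrices of rank m under the map sending a matrix to the span of its rows. *)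
Section linsub_topology.
Variables (R : realType) (n : nat).

Definition linsub_open : set_system (linsub R n) :=
  [set U | forall m, exists2 V : set 'M[R]_(m, n), open V &
    forall A, row_free A -> (V A <-> U (rowspan A))].

Let linsub_openT : linsub_open setT.
Proof. by move=> m; exists setT => //; exact: openT. Qed.

Let linsub_openI : setI_closed linsub_open.
Proof.
move=> U1 U2 o1 o2 m; have [V1 oV1 h1] := o1 m; have [V2 oV2 h2] := o2 m.
exists (V1 `&` V2); first exact: openI.
by move=> A fA; split=> -[/(h1 _ fA) ? /(h2 _ fA) ?].
Qed.

Let linsub_open_bigU (I : Type) (f : I -> set (linsub R n)) :
  (forall i, linsub_open (f i)) -> linsub_open (\bigcup_i f i).
Proof.
move=> of_ m.
have /choice[V hV] : forall i, exists V : set 'M[R]_(m, n), open V /\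
    forall A, row_free A -> (V A <-> f i (rowspan A)).
  by move=> i; have [V oV h] := of_ i m; exists V.
exists (\bigcup_i V i); first by apply: bigcup_open => i _; exact: (hV i).1.
by move=> A fA; split=> -[i _ /((hV i).2 _ fA) ?]; exists i.
Qed.

HB.instance Definition _ := isOpenTopological.Build (linsub R n)
  linsub_openT linsub_openI linsub_open_bigU.

End linsub_topology.

Notation borel_space T := (g_sigma_algebraType (@open T)).

Definition rotate (R : realType) (n : nat) (u : 'M[R]_n) (E : linsub R n) :
  linsub R n := (linfun (mulmxr u) @: (E : {vspace 'rV[R]_n}))%VS.

Definition orthocomp (R : realType) (n : nat) (E : linsub R n) : linsub R n :=
  (\bigcap_(x <- vbasis (E : {vspace 'rV[R]_n})) lker (linfun (mulmxr x^T)))%VS.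

Lemma mem_rotate (R : realType) (n : nat) (u : 'M[R]_n)
    (E : {vspace 'rV[R]_n}) (y : 'rV[R]_n) :
  y \in (rotate u E : {vspace 'rV[R]_n}) <-> exists2 x, x \in E & y = x *m u.
Proof.
by split=> [/memv_imgP[x xE ->]|[x xE ->]];
  [exists x => //; rewrite lfunE | apply/memv_imgP; exists x => //; rewrite lfunE].
Qed.

Lemma mem_orthocomp (R : realType) (n : nat) (E : {vspace 'rV[R]_n})
    (y : 'rV[R]_n) :
  y \in (orthocomp E : {vspace 'rV[R]_n}) <->
  forall x, x \in E -> dotv x y = 0.
Proof.
have dotE (x : 'rV[R]_n) : (y \in lker (linfun (mulmxr x^T : 'rV[R]_n -> 'M[R]_1)))
                           = (dotv x y == 0).
  rewrite memv_ker lfunE /=; apply/eqP/eqP => [/matrixP/(_ 0 0)|xy].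
    rewrite !mxE => <-; apply: eq_bigr => i _.
    by rewrite mxE mulrC.
  apply/matrixP => i j; rewrite !ord1 !mxE -[RHS]xy; apply: eq_bigr => l _.
  by rewrite mxE mulrC.
have memcap (s : seq 'rV[R]_n) :
    (y \in (\bigcap_(x <- s) lker (linfun (mulmxr x^T : 'rV[R]_n -> 'M[R]_1)))%VS)
    = all (fun x => dotv x y == 0) s.
  elim: s => [|x s IH]; first by rewrite big_nil memvf.
  by rewrite big_cons memv_cap IH dotE.
rewrite /orthocomp memcap; split=> [/allP yE x xE|yE]; last first.
  by apply/allP => x /vbasis_mem xE; apply/eqP/yE.
rewrite (coord_vbasis xE) /dotv.
transitivity (\sum_(j < \dim E) coord (vbasis E) j x * dotv (vbasis E)`_j y).
  under eq_bigr do rewrite summxE mulr_suml.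
  rewrite exchange_big; apply: eq_bigr => j _; rewrite mulr_sumr.
  by apply: eq_bigr => i _; rewrite mxE mulrA.
apply: big1 => j _; have /eqP -> : dotv (vbasis E)`_j y == 0.
  by apply: yE; rewrite mem_nth // size_tuple.
by rewrite mulr0.
Qed.

(* The Haar probability measure of a homogeneous space X of the group G, X being
   a subset of T on which G acts transitively: it is carried by X and invariant
   under G. *)
Definition is_haar (d : measure_display) (T : measurableType d) (R : realType)
    (mu : probability T R) (H : Type) (G : set H) (act : H -> T -> T)
    (X : set T) : Prop :=
  mu X = 1%E /\
  forall u A, G u -> measurable A -> mu (act u @^-1` A) = mu A.

Section haar.
Variables (R : realType) (n : nat).

Definition sphere_in (E : linsub R n) : set 'rV[R]_n :=
  sphere R n `&` [set x | x \in (E : {vspace 'rV[R]_n})].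

Definition grassmannian_through (m : nat) (theta : 'rV[R]_n) :
    set (linsub R n) :=
  grassmannian R n m `&` [set E | theta \in (E : {vspace 'rV[R]_n})].

(* sigma_E on the unit sphere of E; O(E) is the restriction to E of the group of
   the orthogonal transformations of R^n that preserve E. *)
Definition is_haar_sphere_in (E : linsub R n)
    (mu : probability (borel_space 'rV[R]_n) R) : Prop :=
  is_haar mu [set u : 'M[R]_n | orthogonal_group R n u /\ rotate u E = E]
          (fun u x => (x : 'rV[R]_n) *m u) (sphere_in E).

Definition is_haar_grassmannian (m : nat)
    (mu : probability (borel_space (linsub R n)) R) : Prop :=
  is_haar mu (orthogonal_group R n) (@rotate R n) (grassmannian R n m).

Definition is_haar_grassmannian_through (m : nat) (theta : 'rV[R]_n)
    (mu : probability (borel_space (linsub R n)) R) : Prop :=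
  is_haar mu (stabilizer theta) (@rotate R n) (grassmannian_through m theta).

End haar.

Section transforms.
Variables (R : realType) (n : nat).

Definition radon (sigma : linsub R n -> probability (borel_space 'rV[R]_n) R)
    (f : 'rV[R]_n -> R) (E : linsub R n) : R :=
  \int[sigma E]_(x in sphere_in E) f x.

Definition radon_range
    (sigma : linsub R n -> probability (borel_space 'rV[R]_n) R) (m : nat) :
    set (linsub R n -> R) :=
  [set h | exists2 f : 'rV[R]_n -> R, {within sphere R n, continuous f} &
           forall E, grassmannian R n m E -> h E = radon sigma f E].

Definition dual_radon
    (nu : 'rV[R]_n -> probability (borel_space (linsub R n)) R) (m : nat)
    (g : linsub R n -> R) (theta : 'rV[R]_n) : R :=
  \int[nu theta]_(E in grassmannian_through m theta) g E.

(* The operator I, which is its own adjoint: (I o R_k)^* = R_k^* o I. *)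
Definition perp_transform (g : linsub R n -> R) (E : linsub R n) : R :=
  g (orthocomp E).

End transforms.

(* F is of class C^r on the open set U: all the iterated directional derivatives
   of order at most r exist and are continuous on U. *)
Fixpoint is_Cr (R : realType) (V : normedModType R) (r : nat) (U : set V)
    (F : V -> R) : Prop :=
  (forall x, U x -> {for x, continuous F}) /\
  (if r is r'.+1 then
     forall v, (forall x, U x -> derivable F x v) /\ is_Cr r' U ('D_v F)
   else True).

(* The smooth structure of G(n, m) is that of the quotient of the open set of
   matrices of rank m by the submersion rowspan: a function on G(n, m) is
   infinitely smooth if and only if its pullback is. *)
Definition smooth_on_grassmannian (R : realType) (n m : nat)
    (g : linsub R n -> R) : Prop :=
  forall r, is_Cr r [set A : 'M[R]_(m, n) | row_free A] (fun A => g (rowspan A)).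

Definition invariant_on_grassmannian (R : realType) (n m : nat)
    (G : set 'M[R]_n) (g : linsub R n -> R) : Prop :=
  forall u E, G u -> grassmannian R n m E -> g (rotate u E) = g E.

(* Main.v *)
From HB Require Import structures.
Require Import Defs.
From mathcomp Require Import all_boot all_order all_algebra.
From mathcomp Require Import all_classical all_reals all_analysis.
From mathcomp Require Import perm measurable_realfun ring lra zify.

Set Implicit Arguments.
Unset Strict Implicit.
Unset Printing Implicit Defensive.

Import Order.TTheory GRing.Theory Num.Theory.
Import numFieldNormedType.Exports.

Local Open Scope classical_set_scope.
Local Open Scope ring_scope.

(** Write [m = n - k], [Q(E) = |P_E xi0|^2] where [P_E] is the orthogonal
    projection to [E], and [t = m / n].  The function [g] is a multiple of
    [(Q - t)^2 - kappa] with [kappa > 0] small, and [h] is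
    [(1 - (Q - t)^2)^L] with [L] large.  Both depend on [E] only through its
    angle with [xi0], and [g] is negative exactly where [Q] is close to [t].

    Why the dual transforms of [g] are positive.  For fixed [theta], let [E] be
    random, of dimension [m], and contain [theta].  Then [Q(E)] is not
    concentrated at one point: if [xi0 = a theta + w] with [w] orthogonal to
    [theta], then [Q(E) = a^2 + |P_E w|^2].  When [w] is small, [Q(E) >= a^2] is
    larger than [t].  Otherwise the second moment of [|P_E w|^2] about any point
    is bounded below by a multiple of [|w|^4]: by invariance it does not change
    when [w] is replaced by a vector of the same length proportional to [f_i],
    [f_i + f_j] or [f_i - f_j], where the [f_i] are an orthonormal basis of the
    orthogonal complement of [theta]; and for a projection matrix of size [d]
    and rank [r] the squares of the differences of the diagonal entries and of
    the off-diagonal entries have a weighted sum equal to [2 r (d - r) > 0]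
    ([proj_spread], [second_moment_lower]).  Hence [kappa] can be chosen uniformly in [theta].  On the orthogonal complements
    [Q] becomes [1 - Q] and [t] becomes [1 - t = k / n], so the second dual
    transform is covered by the same lemma, with [k] in the place of [m].

    Why the pairing of [g] and [h] is negative.  If it were not so for all [L],
    the integrals of [(1 - (Q - t)^2)^L] would decay like [(1 - kappa)^L].
    However, they do not change if [xi0] is replaced by another unit vector, and
    there is a finite set of unit vectors [v] such that every [E] has one with
    [|P_E v|^2] as close to [t] as desired: the diagonal entries of [P_E] have
    average [t], and one moves from a basis vector where the value is at least
    [t] to one where it is at most [t] ([finite_directions], [concentration]).

    Why [h] is a Radon transform.  By invariance the integral of [<x, xi0>^(2j)]
    over the unit sphere of [E] is a positive constant [c_j] times [Q(E)^j],
    and [c_j] depends on [j] and [m] only ([moment_sphereE]).  Therefore every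
    polynomial in [Q] is the transform of a polynomial in [<x, xi0>^2]
    ([radon_range_horner]), and [h] is such a polynomial. *)

(** * Dot products and reflections *)

Section dot_product.
Variables (R : realType) (n : nat).
Implicit Types (x y z : 'rV[R]_n) (u : 'M[R]_n).

Lemma dotvE x y : dotv x y = (x *m y^T) 0 0.
Proof. by rewrite /dotv !mxE; apply: eq_bigr => i _; rewrite mxE. Qed.

Lemma mulmx_trv x y : x *m y^T = (dotv x y)%:M.
Proof. by rewrite dotvE; apply/matrixP => i j; rewrite !ord1 [RHS]mxE. Qed.

Lemma dotvC x y : dotv x y = dotv y x.
Proof. by rewrite /dotv; apply: eq_bigr => i _; rewrite mulrC. Qed.

Lemma dotvDl x y z : dotv (x + y) z = dotv x z + dotv y z.
Proof. by rewrite !dotvE mulmxDl mxE. Qed.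

Lemma dotvDr x y z : dotv z (x + y) = dotv z x + dotv z y.
Proof. by rewrite dotvC dotvDl !(dotvC z). Qed.

Lemma dotvZl a x y : dotv (a *: x) y = a * dotv x y.
Proof. by rewrite !dotvE -scalemxAl mxE. Qed.

Lemma dotvZr a x y : dotv x (a *: y) = a * dotv x y.
Proof. by rewrite dotvC dotvZl dotvC. Qed.

Lemma dotvNl x y : dotv (- x) y = - dotv x y.
Proof. by rewrite -scaleN1r dotvZl mulN1r. Qed.

Lemma dotvNr x y : dotv x (- y) = - dotv x y.
Proof. by rewrite dotvC dotvNl dotvC. Qed.

Lemma dotv0l x : dotv 0 x = 0.
Proof. by rewrite dotvE mul0mx mxE. Qed.

Lemma dotv_ge0 x : 0 <= dotv x x.
Proof. by apply: sumr_ge0 => i _; rewrite -expr2 sqr_ge0. Qed.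

Lemma dotv_eq0 x : (dotv x x == 0) = (x == 0).
Proof.
apply/idP/eqP => [|->]; last by rewrite dotv0l.
rewrite psumr_eq0 => [/allP x0|i _]; last by rewrite -expr2 sqr_ge0.
apply/rowP => i; have := x0 i (mem_index_enum _).
by rewrite -expr2 sqrf_eq0 mxE => /eqP.
Qed.

Lemma dotv_mulmxl x y (A : 'M[R]_n) : dotv (x *m A) y = dotv x (y *m A^T).
Proof. by rewrite !dotvE trmx_mul trmxK mulmxA. Qed.

Lemma orthogonal_trK u : orthogonal_group R n u -> u^T *m u = 1%:M.
Proof. exact: mulmx1C. Qed.

Lemma dotv_orthogonal u x y : orthogonal_group R n u ->
  dotv (x *m u) (y *m u) = dotv x y.
Proof. by move=> uu; rewrite dotv_mulmxl -mulmxA uu mulmx1. Qed.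

Lemma orthogonal_fix_tr u x : orthogonal_group R n u -> x *m u = x ->
  x *m u^T = x.
Proof. by move=> uu xu; rewrite -{1}xu -mulmxA uu mulmx1. Qed.

(** The Householder reflection in the hyperplane orthogonal to [x - y]: this is
    the source of all the rotations used below. *)
Lemma exists_reflection x y : dotv x x = dotv y y ->
  exists u, [/\ orthogonal_group R n u, u^T = u, x *m u = y &
    forall z, exists c, z *m u = z - (c * dotv z (x - y)) *: (x - y)].
Proof.
move=> xxyy; set d := x - y; have dE : dotv d d = 2 * dotv x d.
  rewrite /d !(dotvDl, dotvDr, dotvNl, dotvNr) (dotvC y x) xxyy; ring.
pose u : 'M[R]_n := 1%:M - (2 / dotv d d) *: (d^T *m d).
have uE z : z *m u = z - (2 / dotv d d * dotv z d) *: d.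
  rewrite /u mulmxBr mulmx1 -scalemxAr mulmxA mulmx_trv mul_scalar_mx.
  by rewrite scalerA.
have uT : u^T = u.
  by rewrite /u linearB linearZ /= trmx_mul trmxK trmx1.
exists u; split => //; last by move=> z; exists (2 / dotv d d); rewrite uE.
- rewrite /orthogonal_group /= uT; apply/row_matrixP => i.
  rewrite !rowE mulmxA !uE mulmx1 dotvDl dotvNl dotvZl.
  have [->|d0] := eqVneq d 0; first by rewrite !scaler0 !subr0.
  rewrite -addrA -opprD -scalerDl.
  have dd0 : dotv d d != 0 by rewrite dotv_eq0.
  set a := dotv d d in dd0 *; set b := dotv _ d.
  suff -> : 2 / a * b + 2 / a * (b - 2 / a * b * a) = 0.
    by rewrite scale0r subr0.
  by field.
- rewrite uE; have [d0|d0] := eqVneq d 0.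
    by rewrite d0 scaler0 subr0; apply/eqP; rewrite -subr_eq0 -/d d0.
  have dd0 : dotv d d != 0 by rewrite dotv_eq0.
  suff -> : 2 / dotv d d * dotv x d = 1 by rewrite scale1r /d opprB addrC subrK.
  by rewrite mulrAC -dE divff.
Qed.

End dot_product.

(** * Orthogonal projections as matrices *)

(** The orthogonal projection to the row space of [A], when [A] is row free. *)
Definition gram_proj (R : realType) n m (A : 'M[R]_(m, n)) : 'M[R]_n :=
  A^T *m invmx (A *m A^T) *m A.

(** Locked: rewriting with rules on transposes and products must not look inside
    the Gram formula. *)
HB.lock Definition projmx (R : realType) n (E : linsub R n) : 'M[R]_n :=
  gram_proj (\matrix_(i < \dim (E : {vspace 'rV[R]_n})) (vbasis E)`_i).

Section orthogonal_projection.
Variables (R : realType) (n : nat).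
Implicit Types (E : {vspace 'rV[R]_n}) (x y : 'rV[R]_n) (P : 'M[R]_n).

(** The squared norm of the projection of [x] to [E], as the quadratic form of
    the projection matrix. *)
Definition sqproj (E : linsub R n) (x : 'rV[R]_n) : R :=
  dotv (x *m projmx E) x.

(** Symmetry makes these conditions determine [P]; the projections to the image
    of a subspace and to its orthogonal complement are found through them. *)
Definition proj_spec E P := [/\ P^T = P, forall x, x \in E -> x *m P = x &
                                forall x, x *m P \in E].

(** Both [P *m P' = P] and [P' *m P = P'], and these are transposes of each
    other. *)
Lemma proj_spec_unique E P P' : proj_spec E P -> proj_spec E P' -> P = P'.
Proof.
move=> [PT PE EP] [PT' PE' EP'].
have PP' : P *m P' = P.
  by apply/row_matrixP => i; rewrite !rowE mulmxA PE'.
have P'P : P' *m P = P'.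
  by apply/row_matrixP => i; rewrite !rowE mulmxA PE.
by rewrite -PP' -[in RHS]P'P -[P' *m P]trmxK trmx_mul PT PT' PP' PT.
Qed.

Lemma mem_rowspan m (A : 'M[R]_(m, n)) x :
  x \in (rowspan A : {vspace 'rV[R]_n}) <-> exists v, x = v *m A.
Proof.
pose X := [tuple of mkseq (fun i => [seq row i A | i <- enum 'I_m]`_i) m].
have XE : [seq row i A | i <- enum 'I_m] = X.
  apply: (@eq_from_nth _ 0); first by rewrite size_map size_enum_ord size_mkseq.
  by move=> i; rewrite size_map size_enum_ord => im; rewrite nth_mkseq.
have XiE (i : 'I_m) : X`_i = row i A.
  by rewrite nth_mkseq // (nth_map i) ?size_enum_ord // nth_ord_enum.
rewrite /rowspan XE; split=> [/coord_span xE|[v ->]].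
  exists (\row_i coord X i x); rewrite mulmx_sum_row xE.
  by apply: eq_bigr => i _; rewrite mxE XiE -xE.
rewrite mulmx_sum_row; apply: memv_suml => i _; apply: memvZ.
by rewrite -XiE memv_span // mem_nth // size_tuple.
Qed.

(** A vector killed by the Gram matrix gives a combination of the rows of [A] of
    norm zero. *)
Lemma row_free_gram m (A : 'M[R]_(m, n)) : row_free A = (A *m A^T \in unitmx).
Proof.
apply/idP/idP => [Af|AA]; last first.
  apply/row_freeP; exists (A^T *m invmx (A *m A^T)).
  by rewrite mulmxA mulmxV.
rewrite -row_free_unit -kermx_eq0; apply/rowV0P => v /sub_kermxP vA.
have : dotv (v *m A) (v *m A) = 0.
  by rewrite dotvE trmx_mul mulmxA -(mulmxA v) vA mul0mx mxE.
by move/eqP; rewrite dotv_eq0 mulmx_free_eq0 // => /eqP.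
Qed.

Lemma gram_projP m (A : 'M[R]_(m, n)) : row_free A ->
  proj_spec (rowspan A) (gram_proj A).
Proof.
move=> Af; have Gu : A *m A^T \in unitmx by rewrite -row_free_gram.
split=> [|x /mem_rowspan[v ->]|x].
- by rewrite /gram_proj !trmx_mul trmxK trmx_inv trmx_mul trmxK mulmxA.
- by rewrite /gram_proj !mulmxA -(mulmxA v) mulmxK.
- by apply/mem_rowspan; exists (x *m (A^T *m invmx (A *m A^T))); rewrite !mulmxA.
Qed.

Lemma mxtrace_gram_proj m (A : 'M[R]_(m, n)) : row_free A ->
  \tr (gram_proj A) = m%:R.
Proof.
rewrite row_free_gram => Gu.
by rewrite /gram_proj mxtrace_mulC mulmxA mulmxV // mxtrace1.
Qed.

Lemma vbasis_row_free E : row_free (\matrix_(i < \dim E) (vbasis E)`_i).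
Proof.
set B := \matrix_i _; rewrite -kermx_eq0; apply/rowV0P => v /sub_kermxP vB.
have /freeP := basis_free (vbasisP E) => /(_ (v 0)) v0.
apply/rowP => i; rewrite [RHS]mxE v0 //.
rewrite -[RHS]vB mulmx_sum_row.
by apply: eq_bigr => j _; rewrite rowK.
Qed.

Lemma rowspan_vbasis E : rowspan (\matrix_(i < \dim E) (vbasis E)`_i) = E.
Proof.
apply/vspaceP => x; apply/idP/idP => [/mem_rowspan[v ->]|xE].
  rewrite mulmx_sum_row; apply: memv_suml => i _; apply: memvZ.
  by rewrite rowK vbasis_mem // mem_nth // size_tuple.
apply/mem_rowspan; exists (\row_i coord (vbasis E) i x).
rewrite mulmx_sum_row {1}(coord_vbasis xE).
by apply: eq_bigr => i _; rewrite mxE rowK.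
Qed.

Lemma projmxP E : proj_spec E (projmx E).
Proof.
by have := gram_projP (vbasis_row_free E); rewrite rowspan_vbasis projmx.unlock.
Qed.

Lemma proj_spec_projmx E P : proj_spec E P -> projmx E = P.
Proof. exact/proj_spec_unique/projmxP. Qed.

Lemma projmx_rowspan m (A : 'M[R]_(m, n)) : row_free A ->
  projmx (rowspan A) = gram_proj A.
Proof. by move=> /gram_projP/proj_spec_projmx. Qed.

Lemma trmx_projmx E : (projmx E)^T = projmx E.
Proof. by have [] := projmxP E. Qed.

Lemma mem_projmx E x : x *m projmx E \in E.
Proof. by have [_ _] := projmxP E; apply. Qed.

Lemma projmx_id E x : x \in E -> x *m projmx E = x.
Proof. by have [_ + _] := projmxP E; apply. Qed.

Lemma mem_projmxE E x : (x \in E) = (x *m projmx E == x).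
Proof.
by apply/idP/eqP => [/projmx_id //|<-]; exact: mem_projmx.
Qed.

Lemma projmx_idem E : projmx E *m projmx E = projmx E.
Proof.
by apply/row_matrixP => i; rewrite !rowE mulmxA projmx_id // mem_projmx.
Qed.

Lemma mxtrace_projmx E : \tr (projmx E) = (\dim E)%:R.
Proof. by rewrite projmx.unlock mxtrace_gram_proj // vbasis_row_free. Qed.

Lemma projmx_rotate (u : 'M[R]_n) E : orthogonal_group R n u ->
  projmx (rotate u E) = u^T *m projmx E *m u.
Proof.
move=> uu; apply: proj_spec_projmx; split=> [|x /mem_rotate[y yE ->]|x].
- by rewrite !trmx_mul trmxK trmx_projmx mulmxA.
- by rewrite !mulmxA -(mulmxA y) uu mulmx1 projmx_id.
- apply/mem_rotate; exists (x *m u^T *m projmx E); first exact: mem_projmx.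
  by rewrite !mulmxA.
Qed.

Lemma projmx_orthocomp E : projmx (orthocomp E) = 1%:M - projmx E.
Proof.
apply: proj_spec_projmx; split=> [|x /mem_orthocomp xE|x].
- by rewrite linearB /= trmx1 trmx_projmx.
- rewrite mulmxBr mulmx1 (_ : x *m projmx E = 0) ?subr0 //.
  apply/eqP; rewrite -dotv_eq0 dotv_mulmxl trmx_projmx -mulmxA projmx_idem.
  by rewrite dotvC xE ?mem_projmx.
- apply/mem_orthocomp => y yE; rewrite mulmxBr mulmx1 dotvDr dotvNr.
  by rewrite (dotvC y (x *m _)) dotv_mulmxl trmx_projmx projmx_id // dotvC subrr.
Qed.

Lemma sqprojE E x : sqproj E x = dotv (x *m projmx E) (x *m projmx E).
Proof.
by rewrite [RHS]dotv_mulmxl trmx_projmx -mulmxA projmx_idem dotvC.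
Qed.

Lemma sqproj_ge0 E x : 0 <= sqproj E x.
Proof. by rewrite sqprojE dotv_ge0. Qed.

Lemma sqproj_orthocomp E x : sqproj (orthocomp E) x = dotv x x - sqproj E x.
Proof.
by rewrite /sqproj projmx_orthocomp mulmxBr mulmx1 dotvDl dotvNl.
Qed.

Lemma sqproj_le E x : sqproj E x <= dotv x x.
Proof. by rewrite -subr_ge0 -sqproj_orthocomp sqproj_ge0. Qed.

Lemma sqproj_rotate (u : 'M[R]_n) E x : orthogonal_group R n u ->
  sqproj (rotate u E) x = sqproj E (x *m u^T).
Proof.
by move=> uu; rewrite /sqproj projmx_rotate // !mulmxA dotv_mulmxl.
Qed.

Lemma sqproj_rotate_fix (u : 'M[R]_n) E x : stabilizer x u ->
  sqproj (rotate u E) x = sqproj E x.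
Proof. by move=> [uu xu]; rewrite sqproj_rotate // orthogonal_fix_tr. Qed.

Lemma mem_sqproj E x : (x \in E) = (sqproj E x == dotv x x).
Proof.
rewrite mem_projmxE -[in RHS]subr_eq0 -(opprB (dotv x x)) -sqproj_orthocomp oppr_eq0.
rewrite sqprojE dotv_eq0 projmx_orthocomp mulmxBr mulmx1 subr_eq0.
by rewrite eq_sym.
Qed.

Lemma grassmannian_trace E m : grassmannian R n m E ->
  \tr (projmx E) = m%:R.
Proof. by move=> <-; exact: mxtrace_projmx. Qed.

Lemma dim_rotate (u : 'M[R]_n) E : orthogonal_group R n u ->
  \dim (rotate u E : {vspace _}) = \dim E.
Proof.
move=> uu; apply/eqP; rewrite -(eqr_nat R) -!mxtrace_projmx projmx_rotate //.
by rewrite mxtrace_mulC mulmxA uu mul1mx.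
Qed.

End orthogonal_projection.

(** * Calculus of functions of class C^r *)

Section smooth_functions.
Variables (R : realType) (V : normedModType R) (U : set V).
Hypothesis oU : open U.
Implicit Types (F G : V -> R) (r : nat).

Let nearU x (P : V -> Prop) : U x -> (forall y, U y -> P y) -> \near x, P x.
Proof. by move=> Ux UP; near=> y; apply: UP; near: y; exact: open_nbhs_nbhs.
Unshelve. all: by end_near. Qed.

Lemma is_Cr_continuous r F x : is_Cr r U F -> U x -> {for x, continuous F}.
Proof. by case: r => [|r] [+ _]; apply. Qed.

Lemma is_CrS r F : is_Cr r.+1 U F -> is_Cr r U F.
Proof.
elim: r F => [|r IH] F [cF dF]; first by split.
by split => // v; split; [exact: (dF v).1 | exact/IH/(dF v).2].
Qed.

Lemma eq_is_Cr r F G : (forall x, U x -> F x = G x) ->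
  is_Cr r U F -> is_Cr r U G.
Proof.
elim: r F G => [|r IH] F G FG [cF dF].
  split => // x Ux; rewrite /prop_for /continuous_at -FG //.
  apply: cvg_trans (cF x Ux); apply: near_eq_cvg; exact: nearU.
split=> [x Ux|v].
  rewrite /prop_for /continuous_at -FG //.
  apply: cvg_trans (cF x Ux); apply: near_eq_cvg; exact: nearU.
split=> [x Ux|].
  apply: near_eq_derivable ((dF v).1 x Ux); exact: nearU.
apply: (IH ('D_v F)) (dF v).2 => x Ux.
by apply: near_eq_derive; exact: nearU.
Qed.

Lemma is_Cr_cst r (a : R) : is_Cr r U (cst a).
Proof.
elim: r a => [|r IH] a; first by split=> // x _; exact: cvg_cst.
split=> [x _|v]; first exact: cvg_cst.
split=> [x _|]; first exact: derivable_cst.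
by apply: eq_is_Cr (IH 0) => x _; rewrite derive_cst.
Qed.

Lemma is_CrD r F G : is_Cr r U F -> is_Cr r U G -> is_Cr r U (F + G).
Proof.
elim: r F G => [|r IH] F G [cF dF] [cG dG].
  by split=> // x Ux; apply: cvgD; [exact: cF|exact: cG].
split=> [x Ux|v]; first by apply: cvgD; [exact: cF|exact: cG].
split=> [x Ux|].
  by apply: derivableD; [exact: (dF v).1|exact: (dG v).1].
apply: eq_is_Cr (IH _ _ (dF v).2 (dG v).2) => x Ux.
by rewrite deriveD //; [exact: (dF v).1|exact: (dG v).1].
Qed.

Lemma is_CrM r F G : is_Cr r U F -> is_Cr r U G -> is_Cr r U (F * G).
Proof.
elim: r F G => [|r IH] F G.
  move=> [cF dF] [cG dG].
  by split=> // x Ux; apply: cvgM; [exact: cF|exact: cG].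
move=> hF hG; have [cF dF] := hF; have [cG dG] := hG.
split=> [x Ux|v]; first by apply: cvgM; [exact: cF|exact: cG].
split=> [x Ux|].
  by apply: derivableM; [exact: (dF v).1|exact: (dG v).1].
apply: eq_is_Cr (is_CrD (IH _ _ (is_CrS hF) (dG v).2)
                        (IH _ _ (is_CrS hG) (dF v).2)) => x Ux.
by rewrite deriveM //; [exact: (dF v).1|exact: (dG v).1].
Qed.

(** Induction on [r], because the derivative of [1 / F] is a product involving
    [1 / F] itself. *)
Lemma is_CrV r F : (forall x, U x -> F x != 0) ->
  is_Cr r U F -> is_Cr r U (fun x => (F x)^-1).
Proof.
move=> F0; elim: r => [|r IH] hF; have [cF dF] := hF.
  by split=> // x Ux; apply: cvgV; [exact: F0|exact: cF].
split=> [x Ux|v]; first by apply: cvgV; [exact: F0|exact: cF].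
split=> [x Ux|]; first by apply: derivableV; [exact: F0|exact: (dF v).1].
have hV := IH (is_CrS hF).
apply: eq_is_Cr (is_CrM (is_CrM (is_Cr_cst r (-1)) (is_CrM hV hV)) (dF v).2).
move=> x Ux; rewrite deriveV; [|exact: F0|exact: (dF v).1].
by rewrite /= mulN1r -[in RHS]exprVn expr2.
Qed.

Lemma is_Cr_sum r I (s : seq I) (F : I -> V -> R) :
  (forall i, is_Cr r U (F i)) -> is_Cr r U (fun x => \sum_(i <- s) F i x).
Proof.
move=> hF; elim: s => [|i s IH].
  by apply: eq_is_Cr (is_Cr_cst r 0) => x _; rewrite big_nil.
by apply: eq_is_Cr (is_CrD (hF i) IH) => x _; rewrite big_cons.
Qed.

Lemma is_Cr_prod r I (s : seq I) (F : I -> V -> R) :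
  (forall i, is_Cr r U (F i)) -> is_Cr r U (fun x => \prod_(i <- s) F i x).
Proof.
move=> hF; elim: s => [|i s IH].
  by apply: eq_is_Cr (is_Cr_cst r 1) => x _; rewrite big_nil.
by apply: eq_is_Cr (is_CrM (hF i) IH) => x _; rewrite big_cons.
Qed.

Definition is_Cr_mx r p q (F : V -> 'M[R]_(p, q)) : Prop :=
  forall i j, is_Cr r U (fun x => F x i j).

Lemma is_Cr_mx_cst r p q (A : 'M[R]_(p, q)) : is_Cr_mx r (fun=> A).
Proof. by move=> i j; exact: is_Cr_cst. Qed.

Lemma is_Cr_mx_tr r p q (F : V -> 'M[R]_(p, q)) :
  is_Cr_mx r F -> is_Cr_mx r (fun x => (F x)^T).
Proof. by move=> hF i j; apply: eq_is_Cr (hF j i) => x _; rewrite mxE. Qed.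

Lemma is_Cr_mx_mul r p q s (F : V -> 'M[R]_(p, q)) (G : V -> 'M[R]_(q, s)) :
  is_Cr_mx r F -> is_Cr_mx r G -> is_Cr_mx r (fun x => F x *m G x).
Proof.
move=> hF hG i j.
apply: eq_is_Cr (is_Cr_sum (index_enum 'I_q) (fun l => is_CrM (hF i l) (hG l j))).
by move=> x _; rewrite mxE.
Qed.

Lemma is_Cr_det r p (F : V -> 'M[R]_p) :
  is_Cr_mx r F -> is_Cr r U (fun x => \det (F x)).
Proof.
move=> hF; pose t (s : 'S_p) := is_CrM (is_Cr_cst r ((-1) ^+ s))
  (is_Cr_prod (index_enum 'I_p) (fun i => hF i (s i))).
by apply: eq_is_Cr (is_Cr_sum (index_enum 'S_p) t).
Qed.

Lemma is_Cr_mx_invmx r p (F : V -> 'M[R]_p) :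
  (forall x, U x -> F x \in unitmx) ->
  is_Cr_mx r F -> is_Cr_mx r (fun x => invmx (F x)).
Proof.
move=> Fu hF i j.
have hV : is_Cr r U (fun x => (\det (F x))^-1).
  apply: is_CrV (is_Cr_det hF) => x Ux.
  by rewrite -unitfE -unitmxE Fu.
have hcof : is_Cr r U (fun x => \det (row' j (col' i (F x)))).
  apply: is_Cr_det => i' j'.
  by apply: eq_is_Cr (hF (lift j i') (lift i j')) => x _; rewrite !mxE.
apply: eq_is_Cr (is_CrM hV (is_CrM (is_Cr_cst r ((-1) ^+ (j + i))) hcof)).
by move=> x Ux; rewrite /invmx Fu // !mxE.
Qed.

End smooth_functions.

Section smooth_sqproj.
Variables (R : realType) (m n : nat).

Lemma is_Cr_coord r (U : set 'M[R]_(m, n)) : open U ->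
  is_Cr_mx U r (fun A : 'M[R]_(m, n) => A).
Proof.
move=> oU i j; case: r => [|r]; split => //.
- by move=> A _; exact: coord_continuous.
- by move=> A _; exact: coord_continuous.
move=> v; have dv (A : 'M[R]_(m, n)) :
    is_derive A v (fun A : 'M[R]_(m, n) => A i j) (v i j).
  have c : (fun h : R => h^-1 *:
      (((fun A : 'M[R]_(m, n) => A i j) \o shift A) (h *: v) - A i j)) @ 0^'
      --> v i j.
    apply: cvg_near_cst; near=> h.
    rewrite /= !mxE addrK /GRing.scale /= mulKf //.
    near: h; exact: nbhs_dnbhs_neq.
  by apply: DeriveDef; [apply/cvg_ex; exists (v i j)|exact: cvg_lim c].
split=> [A _|]; first exact: ex_derive.
apply: eq_is_Cr (is_Cr_cst _ r (v i j)) => // A _.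
by rewrite derive_val.
Unshelve. all: by end_near. Qed.

Lemma open_row_free : open [set A : 'M[R]_(m, n) | row_free A].
Proof.
have cdet : continuous (fun A : 'M[R]_(m, n) => \det (A *m A^T)).
  have hA : is_Cr_mx setT 0 (fun A : 'M[R]_(m, n) => A).
    by apply: is_Cr_coord; exact: openT.
  have hdet : is_Cr 0 setT (fun A : 'M[R]_(m, n) => \det (A *m A^T)).
    by apply/is_Cr_det/is_Cr_mx_mul/is_Cr_mx_tr => //; exact: openT.
  by move=> A; exact: is_Cr_continuous hdet I.
rewrite (_ : mkset _ =
    (fun A : 'M[R]_(m, n) => \det (A *m A^T)) @^-1` [set c | c != 0]).
  by apply: open_comp => [A _|]; [exact: cdet|exact: open_neq].
by apply/seteqP; split=> A; rewrite /= row_free_gram unitmxE unitfE.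
Qed.

(** The Gram formula is a rational function of the entries of [A] whose
    denominator is the Gram determinant. *)
Lemma is_Cr_sqproj_rowspan r (x : 'rV[R]_n) :
  is_Cr r [set A : 'M[R]_(m, n) | row_free A] (fun A => sqproj (rowspan A) x).
Proof.
have oU := open_row_free.
set U := [set _ | _] in oU *.
have hA : is_Cr_mx U r (fun A : 'M[R]_(m, n) => A) by exact: is_Cr_coord.
have hAT := is_Cr_mx_tr oU hA.
have hG : is_Cr_mx U r (fun A => invmx (A *m A^T)).
  apply: is_Cr_mx_invmx (is_Cr_mx_mul oU hA hAT) => // A.
  by rewrite -row_free_gram.
have hP := is_Cr_mx_mul oU (is_Cr_mx_mul oU hAT hG) hA.
have hx := is_Cr_mx_cst oU r x; have hxT := is_Cr_mx_cst oU r x^T.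
apply: eq_is_Cr (is_Cr_mx_mul oU (is_Cr_mx_mul oU hx hP) hxT 0 0) => // A Af.
by rewrite /sqproj projmx_rowspan // dotvE.
Qed.

End smooth_sqproj.

(** * Continuity and measurability on the Grassmannian *)

Section topology.
Variables (R : realType) (n : nat).

Lemma continuous_mx (T : topologicalType) p q (F : T -> 'M[R]_(p, q)) :
  (forall i j, continuous (fun x => F x i j)) -> continuous F.
Proof.
move=> cF x A [P nP sPA].
suff : \near x, forall i j, P i j (F x i j) by apply: filterS => y Fy; exact: sPA.
apply: filter_forall => i; apply: filter_forall => j; exact: cF (nP i j).
Qed.

Lemma continuous_mulmxr p q s (A : 'M[R]_(q, s)) :
  continuous (fun B : 'M[R]_(p, q) => B *m A).
Proof.
apply: continuous_mx => i j B.
have hB : is_Cr_mx setT 0 (fun B : 'M[R]_(p, q) => B).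
  by apply: is_Cr_coord; exact: openT.
have := is_Cr_mx_mul openT hB (is_Cr_mx_cst openT 0 A) i j.
by move=> /is_Cr_continuous; apply.
Qed.

Lemma open_linsub (W : set (linsub R n)) : open W = linsub_open W.
Proof. by []. Qed.

Lemma sqproj_continuous (x : 'rV[R]_n) :
  continuous (fun E : linsub R n => sqproj E x).
Proof.
apply/continuousP => W oW; rewrite open_linsub => m.
exists ([set A : 'M[R]_(m, n) | row_free A] `&`
    (fun A => sqproj (rowspan A) x) @^-1` W); last first.
  by move=> A Af; split=> [[]|].
have oU : open [set A : 'M[R]_(m, n) | row_free A] by exact: open_row_free.
have cF := is_Cr_continuous (is_Cr_sqproj_rowspan m 0 x).
move: oU oW; rewrite !openE => oU oW A [Af WA]; apply: filterI; first exact: oU.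
exact: cF (oW _ WA).
Qed.

Lemma rotate_rowspan m (A : 'M[R]_(m, n)) (u : 'M[R]_n) :
  rotate u (rowspan A) = rowspan (A *m u).
Proof.
apply/vspaceP => x; apply/idP/idP => [/mem_rotate[y /mem_rowspan[v ->] ->]|].
  by apply/mem_rowspan; exists v; rewrite mulmxA.
move=> /mem_rowspan[v ->]; apply/mem_rotate; exists (v *m A).
  by apply/mem_rowspan; exists v.
by rewrite mulmxA.
Qed.

Lemma rotate_continuous (u : 'M[R]_n) : orthogonal_group R n u ->
  continuous (@rotate R n u).
Proof.
move=> uu; apply/continuousP => W; rewrite !open_linsub => oW m.
have [V oV hV] := oW m.
exists ((fun A : 'M[R]_(m, n) => A *m u) @^-1` V).
  by apply: open_comp oV => A _; exact: continuous_mulmxr.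
move=> A Af; rewrite /preimage /= rotate_rowspan; apply: hV.
rewrite /row_free mxrankMfree //.
by apply/row_freeP; exists u^T.
Qed.

Lemma open_grassmannian m : open (grassmannian R n m).
Proof.
rewrite open_linsub => p; have [->|pm] := eqVneq p m.
  exists setT; first exact: openT.
  by move=> A Af; split=> // _; exact: rowspan_grassmannian.
exists set0; first exact: open0.
move=> A Af; split=> // Am; move/eqP: pm; apply.
by rewrite -Am (rowspan_grassmannian Af).
Qed.

Lemma borel_continuous (T : ptopologicalType) (f : T -> R) :
  continuous f -> measurable_fun setT (f : borel_space T -> R).
Proof.
move=> /continuousP cf; apply: (measurability _ (RGenOInfty.measurableE R)).
move=> _ [_ [x ->] <-]; rewrite setTI; apply: sub_sigma_algebra.
by apply: cf; exact: interval_open.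
Qed.

Lemma borel_continuous_map (T : ptopologicalType) (f : T -> T) :
  continuous f -> measurable_fun setT (f : borel_space T -> borel_space T).
Proof.
move=> /continuousP cf; apply: measurability; first by [].
move=> _ [W oW <-]; rewrite setTI; apply: sub_sigma_algebra; exact: cf.
Qed.

Lemma measurable_grassmannian m :
  measurable (grassmannian R n m : set (borel_space (linsub R n))).
Proof. by apply: sub_sigma_algebra; exact: open_grassmannian. Qed.

Lemma measurable_grassmannian_through m (theta : 'rV[R]_n) :
  measurable (grassmannian_through m theta : set (borel_space (linsub R n))).
Proof.
apply: measurableI; first exact: measurable_grassmannian.
have := borel_continuous (@sqproj_continuous theta) measurableT
  (measurable_set1 (dotv theta theta)).
rewrite setTI (_ : _ @^-1` _ = [set E | theta \in (E : {vspace _})]) //.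
apply/seteqP; split=> E /=; rewrite mem_sqproj => /eqP //.
Qed.

Lemma dotvl_continuous (w : 'rV[R]_n) : continuous (fun x => dotv x w).
Proof.
move=> x; have hB : is_Cr_mx setT 0 (fun x : 'rV[R]_n => x).
  by apply: is_Cr_coord; exact: openT.
have := is_Cr_mx_mul openT hB (is_Cr_mx_cst openT 0 w^T) 0 0.
under eq_fun do rewrite -dotvE.
by move=> /is_Cr_continuous; apply.
Qed.

End topology.

(** * Integrals of bounded functions against probability measures *)

Section bounded_measurable.
Context d (T : measurableType d) (R : realType) (D : set T).
Implicit Types f g : T -> R.

(** The bound is required on [D] only: linear forms are bounded on a sphere but
    not on the whole space. *)
Definition bounded_mfun f :=
  measurable_fun setT f /\ exists M, forall x, D x -> `|f x| <= M.

Lemma bmf_cst a : bounded_mfun (fun=> a).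
Proof. by split; [exact: measurable_cst|exists `|a|]. Qed.

Lemma bmfD f g : bounded_mfun f -> bounded_mfun g ->
  bounded_mfun (fun x => f x + g x).
Proof.
move=> [mf [M fM]] [mg [N gN]]; split; first exact: measurable_funD.
by exists (M + N) => x Dx; rewrite (le_trans (ler_normD _ _)) // lerD ?fM ?gN.
Qed.

Lemma bmfM f g : bounded_mfun f -> bounded_mfun g ->
  bounded_mfun (fun x => f x * g x).
Proof.
move=> [mf [M fM]] [mg [N gN]]; split; first exact: measurable_funM.
by exists (M * N) => x Dx; rewrite normrM ler_pM ?fM ?gN.
Qed.

Lemma bmfZ a f : bounded_mfun f -> bounded_mfun (fun x => a * f x).
Proof. exact/bmfM/bmf_cst. Qed.

Lemma bmfB f g : bounded_mfun f -> bounded_mfun g ->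
  bounded_mfun (fun x => f x - g x).
Proof.
move=> hf /(bmfZ (-1)) hg; have := bmfD hf hg.
by under eq_fun do rewrite mulN1r.
Qed.

Lemma bmfX f k : bounded_mfun f -> bounded_mfun (fun x => f x ^+ k).
Proof.
move=> hf; elim: k => [|k IH]; first exact: bmf_cst.
by have := bmfM hf IH; under eq_fun do rewrite -exprS.
Qed.

Lemma bmf_sum I (s : seq I) (f : I -> T -> R) :
  (forall i, bounded_mfun (f i)) -> bounded_mfun (fun x => \sum_(i <- s) f i x).
Proof.
move=> hf; elim: s => [|i s IH].
  by under eq_fun do rewrite big_nil; exact: bmf_cst.
by under eq_fun do rewrite big_cons; exact: bmfD.
Qed.

Variable mu : probability T R.
Hypotheses (mD : measurable D) (muD : mu D = 1%E).

Lemma bmf_integrable f : bounded_mfun f -> mu.-integrable D (EFin \o f).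
Proof.
move=> [mf [M fM]]; apply: measurable_bounded_integrable => //.
- by have h : (mu D < +oo)%E by rewrite muD ltry.
- exact: measurable_funTS.
- exists M; split=> [|N MN x Dx]; first exact: num_real.
  by apply: (le_trans (fM x Dx)); exact: ltW.
Qed.

Lemma Rintegral_prob_cst a : \int[mu]_(x in D) a = a.
Proof.
by rewrite Rintegral_cst // -[RHS]mulr1; congr (_ * _); exact: (congr1 fine muD).
Qed.

Lemma bmf_RintegralD f g : bounded_mfun f -> bounded_mfun g ->
  \int[mu]_(x in D) (f x + g x) = \int[mu]_(x in D) f x + \int[mu]_(x in D) g x.
Proof. by move=> hf hg; rewrite RintegralD //; exact: bmf_integrable. Qed.

Lemma bmf_RintegralB f g : bounded_mfun f -> bounded_mfun g ->
  \int[mu]_(x in D) (f x - g x) = \int[mu]_(x in D) f x - \int[mu]_(x in D) g x.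
Proof. by move=> hf hg; rewrite RintegralB //; exact: bmf_integrable. Qed.

Lemma bmf_RintegralZ a f : bounded_mfun f ->
  \int[mu]_(x in D) (a * f x) = a * \int[mu]_(x in D) f x.
Proof. by move=> hf; rewrite RintegralZl //; exact: bmf_integrable. Qed.

Lemma bmf_Rintegral_sum I (s : seq I) (f : I -> T -> R) :
  (forall i, bounded_mfun (f i)) ->
  \int[mu]_(x in D) (\sum_(i <- s) f i x) = \sum_(i <- s) \int[mu]_(x in D) f i x.
Proof.
move=> hf; elim: s => [|i s IH].
  by under eq_Rintegral do rewrite big_nil; rewrite Rintegral_prob_cst big_nil.
under eq_Rintegral do rewrite big_cons.
by rewrite bmf_RintegralD ?IH ?big_cons //; exact: bmf_sum.
Qed.

Lemma bmf_le_Rintegral f g : bounded_mfun f -> bounded_mfun g ->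
  (forall x, D x -> f x <= g x) ->
  \int[mu]_(x in D) f x <= \int[mu]_(x in D) g x.
Proof. by move=> hf hg fg; apply: le_Rintegral => //; exact: bmf_integrable. Qed.

Lemma Rintegral_invariant (phi : T -> T) f :
  measurable_fun setT phi -> (forall x, D (phi x) <-> D x) ->
  (forall A, measurable A -> mu (phi @^-1` A) = mu A) -> bounded_mfun f ->
  \int[mu]_(x in D) f (phi x) = \int[mu]_(x in D) f x.
Proof.
move=> mphi Dphi muphi [mf bf]; rewrite /Rintegral; congr fine.
have phiD : phi @^-1` D = D by apply/seteqP; split=> x /Dphi.
have -> : (\int[mu]_(x in D) (f x)%:E =
           \int[pushforward mu phi]_(x in D) (f x)%:E)%E.
  by apply: eq_measure_integral => A mA _; exact/esym/muphi.
rewrite (@integral_pushforward _ _ _ _ _ phi mphi mu D (EFin \o f)) ?phiD //.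
  exact/measurable_EFinP.
apply: bmf_integrable; split; first exact: measurableT_comp.
by case: bf => M fM; exists M => x /Dphi; exact: fM.
Qed.

End bounded_measurable.

(** * Second moments over the subspaces through a point *)

Lemma bmf_sqproj (R : realType) n (D : set (borel_space (linsub R n)))
  (x : 'rV[R]_n) : bounded_mfun D (fun E : borel_space (linsub R n) => sqproj E x).
Proof.
split; first exact: (borel_continuous (@sqproj_continuous R n x)).
by exists (dotv x x) => E _; rewrite ger0_norm ?sqproj_ge0 ?sqproj_le.
Qed.

Lemma sum_sqr_diff (R : comNzRingType) d (a : 'I_d -> R) :
  \sum_i \sum_j (a i - a j) ^+ 2 =
  2 * d%:R * \sum_i a i ^+ 2 - 2 * (\sum_i a i) ^+ 2.
Proof.
have inner i : \sum_j (a i - a j) ^+ 2 =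
    d%:R * a i ^+ 2 + (- 2 * \sum_j a j) * a i + \sum_j a j ^+ 2.
  transitivity (\sum_j (a i ^+ 2 + (- 2 * a i) * a j + a j ^+ 2)).
    by apply: eq_bigr => j _; ring.
  rewrite !big_split /= sumr_const card_ord -mulr_sumr -mulr_natl; ring.
under eq_bigr do rewrite inner.
rewrite !big_split /= sumr_const card_ord -mulr_natl -!mulr_sumr; ring.
Qed.

(** The squares of all entries of [N] add up to [\tr (N *m N) = \tr N], so what
    is not on the diagonal is off the diagonal.  Over an ordered field the
    right-hand side is positive unless [N] is [0] or [1], and this measures how
    far the quadratic form of [N] is from being constant on the sphere. *)
Lemma proj_spread (R : comNzRingType) d (N : 'M[R]_d) :
  N^T = N -> N *m N = N ->
  \sum_i \sum_j ((N i i - N j j) ^+ 2 +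
     (if j == i then 0 else 2 * d%:R * N i j ^+ 2)) =
  2 * \tr N * (d%:R - \tr N).
Proof.
move=> NT NN; under eq_bigr do rewrite big_split.
rewrite big_split /= sum_sqr_diff.
have -> : \sum_i \sum_j (if j == i then 0 else 2 * d%:R * N i j ^+ 2) =
    2 * d%:R * (\tr N - \sum_i N i i ^+ 2).
  have -> : \tr N = \sum_i \sum_j N i j ^+ 2.
    rewrite -{1}NN; apply: eq_bigr => i _; rewrite mxE.
    by apply: eq_bigr => j _; rewrite -{2}NT mxE expr2.
  rewrite -sumrB mulr_sumr; apply: eq_bigr => i _.
  rewrite (bigD1 i) //= eqxx add0r [in RHS](bigD1 i) //= [X in X - _]addrC addrK.
  by rewrite mulr_sumr; apply: eq_bigr => j /negPf ->.
rewrite /mxtrace; ring.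
Qed.

(** The rows of [B] are those of a reflection exchanging the first basis vector and
    [theta], except the first row. *)
Lemma orthonormal_frame (R : realType) n (theta : 'rV[R]_n.+1) :
  dotv theta theta = 1 ->
  exists B : 'M[R]_(n, n.+1),
    B *m B^T = 1%:M /\ B^T *m B = 1%:M - theta^T *m theta.
Proof.
move=> th1.
have e1 : dotv (delta_mx 0 0 : 'rV[R]_n.+1) (delta_mx 0 0) = dotv theta theta.
  rewrite th1 /dotv (bigD1 0) //= big1 ?addr0 => [|i /negPf i0].
    by rewrite !mxE eqxx mulr1.
  by rewrite !mxE i0 mulr0.
have [u [uu uT eu _]] := exists_reflection e1.
have u0 k : u 0 k = theta 0 k by rewrite -eu -rowE mxE.
exists (row' 0 u); split.
  apply/matrixP => i j; rewrite !mxE.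
  transitivity ((u *m u^T) (lift 0 i) (lift 0 j)).
    by rewrite mxE; apply: eq_bigr => k _; rewrite !mxE.
  by rewrite uu mxE (inj_eq lift_inj).
apply/matrixP => i j; have /matrixP/(_ i j) := orthogonal_trK uu.
rewrite !mxE big_ord_recl big_ord1 !mxE !u0 => <-; rewrite addrC addKr.
by apply: eq_bigr => k _; rewrite !mxE.
Qed.

Section grassmannian_through.
Variables (R : realType) (n m : nat) (theta : 'rV[R]_n).
Variable mu : probability (borel_space (linsub R n)) R.
Hypotheses (th1 : sphere R n theta)
  (hmu : is_haar_grassmannian_through m theta mu).

Let D : set (borel_space (linsub R n)) := grassmannian_through m theta.
Let mD : measurable D. Proof. exact: measurable_grassmannian_through. Qed.
Let muD : mu D = 1%E. Proof. by case: hmu. Qed.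

(** By a reflection fixing [theta], the law of [sqproj E x] depends on [x] only
    through its norm as long as [x] is orthogonal to [theta]. *)
Lemma through_eq_moment (x y : 'rV[R]_n) (c : R) :
  dotv theta x = 0 -> dotv theta y = 0 -> dotv x x = dotv y y ->
  \int[mu]_(E in D) (sqproj E x - c) ^+ 2 =
  \int[mu]_(E in D) (sqproj E y - c) ^+ 2.
Proof.
move=> tx ty xy; have [u [uu uT xu uz]] := exists_reflection xy.
have tu : theta *m u = theta.
  by have [a ->] := uz theta; rewrite dotvDr dotvNr tx ty subr0 mulr0 scale0r subr0.
rewrite -(@Rintegral_invariant _ _ _ _ _ mD muD (@rotate R n u)
   (fun E => (sqproj E x - c) ^+ 2)).
- by apply: eq_Rintegral => E _; rewrite sqproj_rotate // uT xu.
- exact: (borel_continuous_map (rotate_continuous uu)).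
- move=> E; rewrite /D /grassmannian_through /grassmannian /setI /=.
  by rewrite dim_rotate // !mem_sqproj sqproj_rotate_fix.
- by move=> A mA; apply hmu.2.
- apply/bmfX/bmfB; [exact: bmf_sqproj|exact: bmf_cst].
Qed.

End grassmannian_through.

Section second_moment.
Variables (R : realType) (n m : nat) (theta : 'rV[R]_n.+1).
Variable mu : probability (borel_space (linsub R n.+1)) R.
Hypotheses (th1 : sphere R n.+1 theta) (hm : (1 < m < n.+1)%N)
  (hmu : is_haar_grassmannian_through m theta mu).

Let D : set (borel_space (linsub R n.+1)) := grassmannian_through m theta.
Let mD : measurable D. Proof. exact: measurable_grassmannian_through. Qed.
Let muD : mu D = 1%E. Proof. by case: hmu. Qed.

(** The trace of the projection, compressed to the orthogonal complement of
    [theta], is [m - 1], strictly between [0] and [n]; so the right-hand side of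
    [proj_spread] is positive for every [E].  The left-hand side is made of
    squares of differences of two values of [sqproj E] at vectors of the same
    length as [w], whose second moments about [c] are all the same. *)
Lemma second_moment_orthogonal (w : 'rV[R]_n.+1) (c : R) :
  dotv theta w = 0 ->
  dotv w w ^+ 2 <=
  n%:R ^+ 2 * (n%:R + 2) * \int[mu]_(E in D) (sqproj E w - c) ^+ 2.
Proof.
move=> tw; set v := (X in _ * X).
have [B [BB BtB]] := orthonormal_frame th1.
set b2 := dotv w w; have b20 : 0 <= b2 by exact: dotv_ge0.
(* [b] and [s] scale [f_i] and [f_i + e *: f_j] to the length of [w]. *)
set b := Num.sqrt b2; have bE : b ^+ 2 = b2 by rewrite sqr_sqrtr.
set s := Num.sqrt (b2 / 2); have sE : s ^+ 2 = b2 / 2.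
  by rewrite sqr_sqrtr // divr_ge0.
pose f i := row i B.
have fE i j : dotv (f i) (f j) = (i == j)%:R.
  have /matrixP/(_ i j) := BB; rewrite !mxE => <-.
  by apply: eq_bigr => k _; rewrite !mxE.
have thB : theta *m B^T = 0.
  have thth : theta *m theta^T = 1%:M by rewrite mulmx_trv th1.
  by rewrite -[LHS]mulmx1 -BB mulmxA -(mulmxA theta) BtB mulmxBr mulmx1 mulmxA
    thth mul1mx subrr mul0mx.
have Bth : B *m theta^T = 0 by rewrite -[LHS]trmxK trmx_mul trmxK thB trmx0.
have thf i : dotv theta (f i) = 0.
  have /matrixP/(_ 0 i) := thB; rewrite !mxE => h; rewrite -[RHS]h.
  by apply: eq_bigr => k _; rewrite !mxE.
pose N E := B *m projmx E *m B^T.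
have NT E : (N E)^T = N E by rewrite /N !trmx_mul trmxK trmx_projmx mulmxA.
have NE E i j : dotv (f i *m projmx E) (f j) = N E i j.
  rewrite /N /f -row_mul !mxE; apply: eq_bigr => k _.
  by rewrite [row i _ _ _]mxE [row j _ _ _]mxE [B^T _ _]mxE.
have DE E : D E -> theta *m projmx E = theta /\ \tr (projmx E) = m%:R.
  by move=> [Em thE]; split; [exact: projmx_id|exact: grassmannian_trace].
have NN E : D E -> N E *m N E = N E.
  move=> /DE[thP _]; have Pth : projmx E *m theta^T = theta^T.
    by rewrite -[LHS]trmxK trmx_mul trmxK trmx_projmx thP.
  have PBP : projmx E *m (B^T *m B) *m projmx E = projmx E - theta^T *m theta.
    rewrite BtB mulmxBr mulmx1 mulmxA Pth mulmxBl projmx_idem.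
    by rewrite -(mulmxA theta^T) thP.
  have -> : N E *m N E = B *m (projmx E *m (B^T *m B) *m projmx E) *m B^T.
    by rewrite /N !mulmxA.
  by rewrite PBP mulmxBr mulmxA Bth mul0mx subr0.
have trN E : D E -> \tr (N E) = m.-1%:R.
  move=> /DE[thP trP]; rewrite /N mxtrace_mulC mulmxA BtB mulmxBl mul1mx.
  rewrite -mulmxA thP linearB /= trP mxtrace_mulC mulmx_trv th1 mxtrace1.
  by rewrite -subn1 natrB // (ltnW (andP hm).1).
pose X i := b *: f i.
pose Y (e : R) i j := s *: (f i + e *: f j).
have XE E i : sqproj E (X i) = b2 * N E i i.
  by rewrite /sqproj -scalemxAl dotvZl dotvZr NE mulrA -expr2 bE.
have YE E (e : R) i j : e ^+ 2 = 1 ->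
    sqproj E (Y e i j) = b2 / 2 * (N E i i + N E j j + 2 * e * N E i j).
  move=> e1; rewrite /sqproj -scalemxAl dotvZl dotvZr mulrA -expr2 sE.
  rewrite mulmxDl -scalemxAl !(dotvDl, dotvDr, dotvZl, dotvZr) !NE.
  have -> : N E j i = N E i j by rewrite -[in LHS]NT mxE.
  transitivity (b2 / 2 * (N E i i + e ^+ 2 * N E j j + 2 * e * N E i j)).
    ring.
  by rewrite e1 mul1r.
have intX i : \int[mu]_(E in D) (sqproj E (X i) - c) ^+ 2 = v.
  apply: through_eq_moment => //; first by rewrite dotvZr thf mulr0.
  by rewrite dotvZl dotvZr fE eqxx mulr1 -expr2 bE.
have intY e i j : e ^+ 2 = 1 -> j != i ->
    \int[mu]_(E in D) (sqproj E (Y e i j) - c) ^+ 2 = v.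
  move=> e1 ji; apply: through_eq_moment => //.
    by rewrite dotvZr dotvDr dotvZr !thf mulr0 addr0 mulr0.
  rewrite dotvZl dotvZr mulrA -expr2 sE !(dotvDl, dotvDr, dotvZl, dotvZr) !fE.
  rewrite !eqxx (negPf ji) eq_sym (negPf ji) -/b2.
  rewrite mulr1n mulr0n.
  by transitivity (b2 / 2 * (1 + e ^+ 2)); [ring|rewrite e1; field].
have bmfq x : bounded_mfun D
    (fun E : borel_space (linsub R n.+1) => (sqproj E x - c) ^+ 2).
  by apply/bmfX/bmfB; [exact: bmf_sqproj|exact: bmf_cst].
(* For [j != i], [F i j] dominates the summand of [proj_spread] times [b2 ^+ 2],
   by [(a - b) ^+ 2 <= 2 * a ^+ 2 + 2 * b ^+ 2] for the differences of the
   values at [X i], [X j] and at [Y 1 i j], [Y (-1) i j]. *)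
pose F i j (E : borel_space (linsub R n.+1)) : R := if j == i then 0 else
  2 * (sqproj E (X i) - c) ^+ 2 + 2 * (sqproj E (X j) - c) ^+ 2 +
  n%:R * ((sqproj E (Y 1 i j) - c) ^+ 2 + (sqproj E (Y (-1) i j) - c) ^+ 2).
have bmfF i j : bounded_mfun D (F i j).
  rewrite /F; case: eqP => _; first exact: bmf_cst.
  by apply: bmfD; [apply: bmfD; exact: bmfZ|apply: bmfZ; exact: bmfD].
have e1 : (1 : R) ^+ 2 = 1 by rewrite expr1n.
have e2 : (-1 : R) ^+ 2 = 1 by rewrite sqrrN expr1n.
have v0 : 0 <= v by apply: Rintegral_ge0 => E _; exact: sqr_ge0.
have intF i j : \int[mu]_(E in D) F i j E <= (4 + 2 * n%:R) * v.
  rewrite /F; have [_|ji] := eqVneq j i.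
    by rewrite (Rintegral_prob_cst mD muD) mulr_ge0 // addr_ge0 // mulr_ge0.
  rewrite (bmf_RintegralD mD muD); last 2 first.
  - by apply: bmfD; exact: bmfZ.
  - by apply: bmfZ; exact: bmfD.
  rewrite (bmf_RintegralD mD muD); [|exact: bmfZ..].
  rewrite !(bmf_RintegralZ mD muD) //; last exact: bmfD.
  rewrite (bmf_RintegralD mD muD) // !intX !intY //.
  by rewrite le_eqVlt; apply/orP; left; apply/eqP; ring.
have key E : D E -> b2 ^+ 2 * (2 * m.-1%:R * (n%:R - m.-1%:R)) <=
    \sum_i \sum_j F i j E.
  move=> DE'; rewrite -(trN E) // -proj_spread ?NN // mulr_sumr.
  apply: ler_sum => i _; rewrite mulr_sumr; apply: ler_sum => j _.
  rewrite /F; have [->|ji] := eqVneq j i.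
    by rewrite subrr expr0n addr0 mulr0.
  rewrite !XE !YE //.
  set Nii := N E i i; set Njj := N E j j; set Nij := N E i j.
  rewrite -subr_ge0.
  set rhs := (X in 0 <= X).
  suff -> : rhs = (b2 * Nii - c + (b2 * Njj - c)) ^+ 2 +
     n%:R * 2 * (b2 / 2 * (Nii + Njj) - c) ^+ 2.
    by rewrite addr_ge0 ?sqr_ge0 // mulr_ge0 ?sqr_ge0 // mulr_ge0.
  by rewrite /rhs; field.
have : b2 ^+ 2 * (2 * m.-1%:R * (n%:R - m.-1%:R)) <= n%:R ^+ 2 * ((4 + 2 * n%:R) * v).
  rewrite -(Rintegral_prob_cst mD muD (b2 ^+ 2 * _)).
  apply: le_trans (_ : \int[mu]_(E in D) (\sum_i \sum_j F i j E) <= _).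
    apply: (bmf_le_Rintegral mD muD) key; first exact: bmf_cst.
    by apply: bmf_sum => i; exact: bmf_sum.
  rewrite (bmf_Rintegral_sum mD muD); last by move=> i; exact: bmf_sum.
  apply: le_trans (_ : \sum_(i < n) \sum_(j < n) (4 + 2 * n%:R) * v <= _).
    apply: ler_sum => i _; rewrite (bmf_Rintegral_sum mD muD) //.
    by apply: ler_sum.
  by rewrite !sumr_const !card_ord -mulrnA -[_ *+ _]mulr_natl natrM expr2.
have r1 : 1 <= (m.-1%:R : R) by rewrite ler1n; lia.
have dr1 : 1 <= n%:R - (m.-1%:R : R).
  by rewrite -natrB ?ler1n; lia.
set r := m.-1%:R in r1 dr1 *; set d := n%:R in dr1 *.
have rd : 1 <= r * (d - r) by rewrite mulr_ege1.
have := ler_wpM2l (sqr_ge0 b2) rd.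
move: (b2 ^+ 2) => b4; nra.
Qed.

End second_moment.

(** Split [xi] into its component along [theta], which every [E] contains, and the
    rest [w].  If [w] is short the first component alone keeps [sqproj E xi] away
    from [t]; if not, [second_moment_orthogonal] applies. *)
Lemma second_moment_lower (R : realType) (n m : nat) (theta xi : 'rV[R]_n)
    (t : R) (mu : probability (borel_space (linsub R n)) R) :
  sphere R n theta -> sphere R n xi -> (1 < m < n)%N -> 0 <= t < 1 ->
  is_haar_grassmannian_through m theta mu ->
  ((1 - t) / 2) ^+ 2 / (n%:R ^+ 2 * (n%:R + 2)) <=
  \int[mu]_(E in grassmannian_through m theta) (sqproj E xi - t) ^+ 2.
Proof.
case: n => [|n] in theta xi mu *; first by rewrite ltn0 andbF.
move=> th1 xi1 hm /andP[t0 t1] hmu.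
have mD := measurable_grassmannian_through m theta.
have muD : mu (grassmannian_through m theta) = 1%E by case: hmu.
set D : set (borel_space (linsub R n.+1)) := grassmannian_through m theta in mD muD *.
set K := _ * (_ + 2); have n1 : 1 <= (n.+1%:R : R) by rewrite ler1n.
have nn : (n%:R : R) <= n.+1%:R by rewrite ler_nat.
have n0 : 0 <= (n%:R : R) by rewrite ler0n.
have K1 : 1 <= K.
  rewrite /K; move: (n.+1%:R : R) n1 => x x1; nra.
have K0 : 0 < K by rewrite (lt_le_trans _ K1).
have KK : n%:R ^+ 2 * (n%:R + 2) <= K.
  by rewrite /K ler_pM ?sqr_ge0 ?addr_ge0 // ?lerD2r // lerXn2r // nnegrE (le_trans n0).
set c0 := ((1 - t) / 2) ^+ 2.
have c00 : 0 <= c0 by exact: sqr_ge0.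
have bmfq x c : bounded_mfun D
    (fun E : borel_space (linsub R n.+1) => (sqproj E x - c) ^+ 2).
  by apply/bmfX/bmfB; [exact: bmf_sqproj|exact: bmf_cst].
pose a := dotv xi theta; pose w := xi - a *: theta.
have thw : dotv theta w = 0.
  by rewrite /w dotvDr dotvNr dotvZr th1 mulr1 /a dotvC subrr.
have wE : dotv w w = 1 - a ^+ 2.
  have -> : dotv w w = dotv xi w - a * dotv theta w.
    by rewrite -dotvZl -dotvNl -dotvDl.
  by rewrite thw mulr0 subr0 /w dotvDr dotvNr dotvZr -/a xi1 expr2.
have xiE : xi = a *: theta + w by rewrite addrC subrK.
clearbody w; have QE E : D E -> sqproj E xi = a ^+ 2 + sqproj E w.
  move=> [_ thE].
  have thP : theta *m projmx E = theta by exact: projmx_id.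
  have wP : dotv (w *m projmx E) theta = 0.
    by rewrite dotv_mulmxl trmx_projmx thP dotvC.
  rewrite {1}xiE /sqproj mulmxDl -scalemxAl thP.
  by rewrite !(dotvDl, dotvDr, dotvZl, dotvZr) wP thw th1; ring.
have [small|large] := lerP (dotv w w) ((1 - t) / 2).
  (* Here [theta] is close to [xi] or [- xi], so that [sqproj E xi] stays above [t]. *)
  apply: (@le_trans _ _ c0); first by rewrite ler_pdivrMr // ler_peMr.
  rewrite -(Rintegral_prob_cst mD muD c0).
  apply: (bmf_le_Rintegral mD muD) => // [|E DE]; first exact: bmf_cst.
  rewrite (QE _ DE); have := sqproj_ge0 E w; rewrite /c0.
  move: (sqproj E w) => s s0; rewrite lerXn2r // ?nnegrE; lra.
have -> : \int[mu]_(E in D) (sqproj E xi - t) ^+ 2 =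
    \int[mu]_(E in D) (sqproj E w - (t - a ^+ 2)) ^+ 2.
  by apply: eq_Rintegral => E /set_mem DE; rewrite (QE _ DE); congr (_ ^+ 2); ring.
have := second_moment_orthogonal th1 hm hmu (t - a ^+ 2) thw.
rewrite -/D; set v := Rintegral _ _ _ => h.
have v0 : 0 <= v by apply: Rintegral_ge0 => E _; exact: sqr_ge0.
rewrite ler_pdivrMr // mulrC; apply: le_trans (ler_wpM2r v0 KK).
by apply: le_trans h; rewrite /c0 lerXn2r // ?nnegrE; lra.
Qed.

(** * Concentration of powers of a peak function *)

Lemma discrete_ivt (R : realDomainType) (a : nat -> R) (K : nat) :
  0 <= a 0%N -> a K.+1 <= 0 -> exists l, [/\ (l <= K)%N, 0 <= a l & a l.+1 <= 0].
Proof.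
move=> a0; elim: K => [|K IH] aK; first by exists 0%N.
have [/IH[l [lK ? ?]]|aK'] := lerP (a K.+1) 0; first by exists l; rewrite leqW.
by exists K.+1; rewrite (ltW aK').
Qed.

Lemma exists_ge_average (R : realDomainType) n (a : 'I_n -> R) (t : R) :
  (0 < n)%N -> \sum_i a i = n%:R * t -> exists i, t <= a i.
Proof.
move=> n0 sa; apply/not_existsP => ha.
have : \sum_i a i < \sum_(i < n) t.
  apply: ltr_sum => [|i _]; last by rewrite ltNge; apply/negP/ha.
  by apply/hasP; exists (Ordinal n0); rewrite ?mem_index_enum.
by rewrite sa sumr_const card_ord mulr_natl ltxx.
Qed.

Lemma bernoulli_le (R : realDomainType) (x : R) L : 0 <= x ->
  1 + L%:R * x <= (1 + x) ^+ L.
Proof.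
move=> x0; elim: L => [|L IH]; first by rewrite mul0r addr0 expr0.
rewrite exprS; apply: le_trans (ler_wpM2l (addr_ge0 ler01 x0) IH).
rewrite -natr1; have : 0 <= L%:R * x * x by rewrite !mulr_ge0.
by move: (L%:R : R) => l; nra.
Qed.

Section directions.
Variables (R : realType) (n m : nat).
Hypothesis n0 : (0 < n)%N.
Let t0 : R := m%:R / n%:R.

Definition basis_vec (i : 'I_n) : 'rV[R]_n := delta_mx 0 i.

Lemma dotv_basis_vec (x : 'rV[R]_n) i : dotv x (basis_vec i) = x 0 i.
Proof.
rewrite /dotv (bigD1 i) //= big1 ?addr0 => [|j /negPf ji].
  by rewrite mxE !eqxx mulr1.
by rewrite mxE ji andbF mulr0.
Qed.

Lemma sqproj_basis_vec (E : linsub R n) i : sqproj E (basis_vec i) = projmx E i i.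
Proof. by rewrite /sqproj dotv_basis_vec /basis_vec -rowE mxE. Qed.

Lemma sum_sqproj_basis_vec (E : linsub R n) : grassmannian R n m E ->
  \sum_i sqproj E (basis_vec i) = m%:R.
Proof.
by move=> /grassmannian_trace <-; apply: eq_bigr => i _; rewrite sqproj_basis_vec.
Qed.

(** Not normalised, and defined also for [i = j]: the quadratic form of [E] is
    then a polynomial of degree 2 in [r]. *)
Definition chord (i j : 'I_n) (r : R) : 'rV[R]_n :=
  (1 - r) *: basis_vec i + r *: basis_vec j.

(** The average of the diagonal entries of the projection to [E] is [t0], so a
    basis vector gives a value at least [t0] and some gives a value at most [t0].
    Along the chord between them, subdivided finely enough, two consecutive
    values enclose [t0], and they are close to each other since the coefficients
    of the polynomial are bounded independently of [E]. *)
Lemma finite_directions (eps : R) : 0 < eps -> exists s : seq 'rV[R]_n,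
  (forall v, v \in s -> sphere R n v) /\
  forall E, grassmannian R n m E ->
    exists2 v, v \in s & (sqproj E v - t0) ^+ 2 <= eps.
Proof.
move=> eps0; pose del := Num.sqrt eps; have del0 : 0 < del by rewrite sqrtr_gt0.
(* 16: consecutive values of the polynomial differ by at most 8 steps of the
   subdivision, and the squared length of a chord vector is at least 1 / 2. *)
pose K := Num.bound (16 / del); have K16 : 16 / del < K.+1%:R.
  have := archi_boundP (divr_ge0 (ler0n R 16) (ltW del0)).
  by move=> /lt_trans; apply; rewrite ltr_nat.
have K0 : 0 < (K.+1%:R : R) by rewrite ltr0n.
pose r l : R := l%:R / K.+1%:R.
have chordE i j x : dotv (chord i j x) (chord i j x) =
    (1 - x) ^+ 2 + x ^+ 2 + 2 * x * (1 - x) * (i == j)%:R.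
  rewrite /chord !(dotvDl, dotvDr, dotvZl, dotvZr) !dotv_basis_vec !mxE !eqxx /=.
  by rewrite [j == i]eq_sym; ring.
have chord_ge i j x : 0 <= x <= 1 -> 1 / 2 <= dotv (chord i j x) (chord i j x).
  rewrite chordE => /andP[x0 x1]; have : 0 <= (i == j)%:R :> R by rewrite ler0n.
  move: (_%:R) => b b0; have : 0 <= x * (1 - x) * b.
    by rewrite !mulr_ge0 // subr_ge0.
  by have := sqr_ge0 (x - 1 / 2); nra.
pose v i j l := (Num.sqrt (dotv (chord i j (r l)) (chord i j (r l))))^-1
                *: chord i j (r l).
have r01 (l : 'I_K.+2) : 0 <= r l <= 1.
  by rewrite divr_ge0 // ler_pdivrMr // mul1r ler_nat -ltnS ltn_ord.
exists [seq v p.1.1 p.1.2 p.2 | p : 'I_n * 'I_n * 'I_K.+2]; split.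
  move=> _ /mapP[[[i j] l] _ ->] /=; rewrite /sphere /= dotvZl dotvZr mulrA.
  rewrite -expr2 exprVn sqr_sqrtr ?dotv_ge0 // mulVf //.
  by apply: lt0r_neq0; have := chord_ge i j _ (r01 l); lra.
move=> E Em; pose q i j := dotv (basis_vec i *m projmx E) (basis_vec j).
have qC i j : q i j = q j i by rewrite /q dotv_mulmxl trmx_projmx dotvC.
have sumQ : \sum_i sqproj E (basis_vec i) = n%:R * t0.
  by rewrite (sum_sqproj_basis_vec Em) /t0 mulrC divfK // pnatr_eq0 -lt0n.
have [i ti] := exists_ge_average n0 sumQ.
have [j tj] : exists j, - t0 <= - sqproj E (basis_vec j).
  by apply: exists_ge_average; rewrite // sumrN sumQ mulrN.
pose F l := sqproj E (chord i j (r l)) - t0 * dotv (chord i j (r l)) (chord i j (r l)).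
pose A := q i i - t0; pose B := q j j - t0; pose C := q i j - t0 * (i == j)%:R.
have FE l : F l = A * (1 - r l) ^+ 2 + B * r l ^+ 2 + C * (2 * r l * (1 - r l)).
  rewrite /F chordE /sqproj /chord mulmxDl -!scalemxAl.
  rewrite !(dotvDl, dotvDr, dotvZl, dotvZr) -!/(q _ _) (qC j i) /A /B /C; ring.
have r_0 : r 0%N = 0 by rewrite /r mul0r.
have r_1 : r K.+1 = 1 by rewrite /r divff // gt_eqF.
have [l [lK Fl Fl1]] : exists l, [/\ (l <= K)%N, 0 <= F l & F l.+1 <= 0].
  apply: discrete_ivt; rewrite FE ?r_0 ?r_1.
    by rewrite /A /q -/(sqproj _ _); lra.
  by rewrite /B /q -/(sqproj _ _); lra.
have lK2 : (l < K.+2)%N by rewrite ltnS ltnW // ltnS.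
exists (v i j l); first by apply/mapP; exists (i, j, Ordinal lK2); rewrite ?mem_enum.
have rl := r01 (Ordinal lK2); rewrite /= in rl.
have := chord_ge i j _ rl; set z := chord i j (r l) => zz.
have z0 : 0 < dotv z z by lra.
have sqv : sqproj E (v i j l) - t0 = F l / dotv z z.
  rewrite /F /v -/z /sqproj -scalemxAl dotvZl dotvZr mulrA -expr2 exprVn.
  by rewrite sqr_sqrtr ?dotv_ge0 //; field; exact: lt0r_neq0.
rewrite sqv -[leRHS](sqr_sqrtr (ltW eps0)) -/del.
rewrite lerXn2r // ?nnegrE ?(ltW del0) ?divr_ge0 ?(ltW z0) //.
rewrite ler_pdivrMr //; have Fd : F l <= F l - F l.+1 by lra.
pose h : R := K.+1%:R^-1; have h0 : 0 < h by rewrite invr_gt0.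
have rS : r l.+1 = r l + h by rewrite /r /h -natr1 mulrDl mul1r.
have hdel : 16 * h < del.
  by rewrite /h ltr_pdivrMr // mulrC -ltr_pdivrMr.
have rh : r l + h <= 1.
  by rewrite -rS /r ler_pdivrMr // mul1r ler_nat ltnS.
have q01 k : 0 <= q k k <= 1.
  rewrite -[q k k]/(sqproj E (basis_vec k)) sqproj_ge0 (le_trans (sqproj_le _ _)) //.
  by rewrite dotv_basis_vec mxE !eqxx.
have t01 : 0 <= t0 <= 1.
  rewrite divr_ge0 //=; apply: le_trans ti _; by case/andP: (q01 i).
have q1 : -1 <= q i j <= 1.
  have := sqproj_ge0 E (basis_vec i + basis_vec j).
  have := sqproj_ge0 E (basis_vec i - basis_vec j).
  rewrite /sqproj !mulmxDl mulNmx !(dotvDl, dotvDr, dotvNl, dotvNr) -!/(q _ _) (qC j i).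
  by have := q01 i; have := q01 j; lra.
have A1 : -1 <= A <= 1 by have := q01 i; rewrite /A; lra.
have B1 : -1 <= B <= 1 by have := q01 j; rewrite /B; lra.
have C1 : -2 <= C <= 2.
  by rewrite /C; case: (i == j); rewrite ?mulr1n ?mulr0n ?mulr1 ?mulr0; lra.
have {Fd} Fd : F l <= h * (A * (2 - 2 * r l - h) - B * (2 * r l + h)
                           - 2 * C * (1 - 2 * r l - h)).
  by apply: le_trans Fd _; rewrite !FE rS le_eqVlt; apply/orP; left; apply/eqP; ring.
have cA : A * (2 - 2 * r l - h) <= 2 by nra.
have cB : - B * (2 * r l + h) <= 2 by nra.
have cC : - C * (1 - 2 * r l - h) <= 2 by nra.
have : F l <= h * 8 by apply: le_trans Fd _; rewrite ler_pM2l //; lra.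
by move=> /le_trans; apply; nra.
Qed.

End directions.

Section concentration.
Variables (R : realType) (n m : nat).
Variable eta : probability (borel_space (linsub R n)) R.
Hypotheses (n0 : (0 < n)%N) (mn : (m <= n)%N) (heta : is_haar_grassmannian m eta).

Let D : set (borel_space (linsub R n)) := grassmannian R n m.
Let mD : measurable D. Proof. exact: measurable_grassmannian. Qed.
Let etaD : eta D = 1%E. Proof. by case: heta. Qed.
Let t0 : R := m%:R / n%:R.

Definition peak (E : linsub R n) (x : 'rV[R]_n) : R := 1 - (sqproj E x - t0) ^+ 2.

Let bmf_peak x L : bounded_mfun D (fun E : borel_space (linsub R n) => peak E x ^+ L).
Proof.
apply/bmfX/bmfB; first exact: bmf_cst.
by apply/bmfX/bmfB; [exact: bmf_sqproj|exact: bmf_cst].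
Qed.

Lemma peak_ge0 E x : sphere R n x -> 0 <= peak E x.
Proof.
move=> x1; have t01 : 0 <= t0 <= 1.
  by rewrite divr_ge0 //= ler_pdivrMr ?ltr0n // mul1r ler_nat.
have := sqproj_ge0 E x; have := sqproj_le E x; rewrite x1 /peak.
move: (sqproj E x) t01 => s; nra.
Qed.

Lemma peak_eq_moment x y L : sphere R n x -> sphere R n y ->
  \int[eta]_(E in D) peak E x ^+ L = \int[eta]_(E in D) peak E y ^+ L.
Proof.
move=> x1 y1; have xy : dotv x x = dotv y y by rewrite x1 y1.
have [u [uu uT xu _]] := exists_reflection xy.
rewrite -(@Rintegral_invariant _ _ _ _ _ mD etaD (@rotate R n u)
   (fun E => peak E x ^+ L)) //.
- by apply: eq_Rintegral => E _; rewrite /peak sqproj_rotate // uT xu.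
- exact: (borel_continuous_map (rotate_continuous uu)).
- by move=> E; rewrite /D /grassmannian /= dim_rotate.
- by move=> A mA; apply heta.2.
Qed.

(** If all these integrals were nonnegative, the integral [J L] of [peak ^+ L]
    would satisfy [J L <= (1 - kappa) ^+ L].  But the sum of [peak ^+ L] over
    finitely many directions is at least [(1 - kappa / 2) ^+ L] at every [E], and
    each term has integral [J L]. *)
Lemma concentration (x : 'rV[R]_n) (kappa : R) : sphere R n x ->
  0 < kappa < 1 -> exists L,
  \int[eta]_(E in D) (((sqproj E x - t0) ^+ 2 - kappa) * peak E x ^+ L) < 0.
Proof.
move=> x1 /andP[k0 k1]; apply/not_existsP => hL.
pose J L := \int[eta]_(E in D) peak E x ^+ L.
have JS L : J L.+1 <= (1 - kappa) * J L.
  have /negP := hL L; rewrite -leNgt.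
  have -> : \int[eta]_(E in D) (((sqproj E x - t0) ^+ 2 - kappa) * peak E x ^+ L)
      = \int[eta]_(E in D) ((1 - kappa) * peak E x ^+ L - peak E x ^+ L.+1).
    by apply: eq_Rintegral => E _; rewrite [peak _ _ ^+ L.+1]exprS;
      move: (_ ^+ L) => b; rewrite /peak; ring.
  rewrite (bmf_RintegralB mD etaD) //; last exact: bmfZ.
  by rewrite (bmf_RintegralZ mD etaD) // subr_ge0.
have Jle L : J L <= (1 - kappa) ^+ L.
  elim: L => [|L IH].
    rewrite /J; under eq_Rintegral do rewrite expr0.
    by rewrite (Rintegral_prob_cst mD etaD).
  by apply: le_trans (JS L) _; rewrite exprS ler_pM2l // subr_gt0.
have [s [s1 hs]] := @finite_directions R n m n0 (kappa / 2) (divr_gt0 k0 (ltr0n R 2)).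
have low L : (1 - kappa / 2) ^+ L <= (size s)%:R * (1 - kappa) ^+ L.
  apply: (@le_trans _ _ (\int[eta]_(E in D) (\sum_(v <- s) peak E v ^+ L))).
    rewrite -[leLHS](Rintegral_prob_cst mD etaD).
    apply: (bmf_le_Rintegral mD etaD); first exact: bmf_cst.
      by apply: bmf_sum => v; exact: bmf_peak.
    move=> E DE; have [v vs qv] := hs E DE.
    rewrite (big_rem v) //= -[leLHS]addr0 lerD //.
      have k2 : 0 <= 1 - kappa / 2 by lra.
      have qb : 1 - kappa / 2 <= peak E v by rewrite lerD2l lerN2.
      by rewrite lerXn2r // nnegrE // (le_trans k2).
    rewrite big_seq; apply: sumr_ge0 => w /mem_rem ws.
    by apply/exprn_ge0/peak_ge0/s1.
  rewrite (bmf_Rintegral_sum mD etaD); last by move=> v; exact: bmf_peak.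
  rewrite mulr_natl -iter_addr_0 -(count_predT s) -big_const_seq.
  rewrite big_seq [leRHS]big_seq; apply: ler_sum => v vs.
  by rewrite (peak_eq_moment L (s1 v vs) x1) Jle.
(* Bernoulli's inequality for the quotient [1 + z] of the two rates. *)
pose z := kappa / 2 / (1 - kappa).
have z0 : 0 < z by rewrite !divr_gt0 // subr_gt0.
pose L := Num.bound ((size s)%:R / z).
have Lz : (size s)%:R < L%:R * z.
  by rewrite -ltr_pdivrMr // archi_boundP // divr_ge0 // ltW.
have := low L; have -> : 1 - kappa / 2 = (1 - kappa) * (1 + z).
  by rewrite /z; field; rewrite subr_eq0 gt_eqF.
have pk : 0 < (1 - kappa) ^+ L by rewrite exprn_gt0 // subr_gt0.
rewrite exprMn mulrC ler_pM2r // => /(le_trans (bernoulli_le L (ltW z0))).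
lra.
Qed.

End concentration.

(** * Moments of linear forms on the unit sphere of a subspace *)

Section sphere_moments.
Variables (R : realType) (n m : nat) (E : linsub R n).
Variable sg : probability (borel_space 'rV[R]_n) R.
Hypotheses (m0 : (0 < m)%N) (hE : grassmannian R n m E)
  (hsg : is_haar_sphere_in E sg).

Let D : set (borel_space 'rV[R]_n) := sphere_in E.

Lemma dotv_mulmx_continuous (A : 'M[R]_n) :
  continuous (fun x : 'rV[R]_n => dotv (x *m A) x).
Proof.
move=> x; have hB : is_Cr_mx setT 0 (fun x : 'rV[R]_n => x).
  by apply: is_Cr_coord; exact: openT.
have hBA := is_Cr_mx_mul openT hB (is_Cr_mx_cst openT 0 A).
have := is_Cr_mx_mul openT hBA (is_Cr_mx_tr openT hB) 0 0.
under eq_fun do rewrite -dotvE.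
by move=> /is_Cr_continuous; apply.
Qed.

Lemma measurable_sphere_in : measurable D.
Proof.
pose F (A : 'M[R]_n) (x : borel_space 'rV[R]_n) := dotv (x *m A) x.
have mF A : measurable_fun setT (F A).
  exact: (borel_continuous (@dotv_mulmx_continuous A)).
rewrite (_ : D = (F 1%:M @^-1` [set 1]) `&` (F (projmx E) @^-1` [set 1])).
  by apply: measurableI; rewrite -[_ @^-1` _]setTI; apply: mF.
rewrite /F /D /sphere_in /sphere; apply/seteqP.
split=> x /=; rewrite mulmx1 mem_sqproj /sqproj => -[-> h]; split=> //.
  exact/eqP.
by rewrite h.
Qed.

Let mD := measurable_sphere_in.
Let sgD : sg D = 1%E. Proof. by case: hsg. Qed.

Lemma bmf_dotv w : bounded_mfun D (fun x : borel_space 'rV[R]_n => dotv x w).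
Proof.
split; first exact: (borel_continuous (@dotvl_continuous R n w)).
exists (1 + dotv w w) => x [/= x1 _].
have := dotv_ge0 (x + w); have := dotv_ge0 (x - w).
rewrite !(dotvDl, dotvDr, dotvNl, dotvNr) (dotvC w x) x1 ler_norml.
by have := dotv_ge0 w; lra.
Qed.

Let M j w := \int[sg]_(x in D) dotv x w ^+ j.

(** The reflection exchanging [w] and [w'] preserves [E], as their difference is
    in [E]. *)
Lemma moment_rotate j w w' : w \in E -> w' \in E -> dotv w w = dotv w' w' ->
  M j w = M j w'.
Proof.
move=> wE wE' ww; have [u [uu uT wu uz]] := exists_reflection ww.
have Eu x : x \in E -> x *m u \in E.
  by move=> xE; have [c ->] := uz x; rewrite rpredB ?rpredZ ?rpredB.
have Eu' x : x *m u \in E -> x \in E.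
  by move=> /Eu; rewrite -mulmxA -{2}uT uu mulmx1.
have rE : rotate u E = E.
  apply/vspaceP => x; apply/idP/idP => [/mem_rotate[y yE ->]|xE]; first exact: Eu.
  by apply/mem_rotate; exists (x *m u); [exact: Eu|rewrite -mulmxA -{2}uT uu mulmx1].
rewrite /M -(@Rintegral_invariant _ _ _ _ _ mD sgD
   (fun x : borel_space 'rV[R]_n => (x : 'rV[R]_n) *m u) (fun x => dotv x w ^+ j)).
- by apply: eq_Rintegral => x _; rewrite dotv_mulmxl uT wu.
- exact: (borel_continuous_map (@continuous_mulmxr R 1 n n u)).
- move=> x; rewrite /D /sphere_in /sphere /= dotv_orthogonal //.
  by split=> -[? /=] => [/Eu'|/Eu].
- by move=> A mA; apply hsg.2.
- by apply: bmfX; exact: bmf_dotv.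
Qed.

Lemma exists_unit_in : exists2 e, e \in E & dotv e e = 1.
Proof.
have [x xE x0] : exists2 x, x \in E & x != 0.
  exists (vpick E); first exact: memv_pick.
  by rewrite vpick0 -dimv_eq0 hE -lt0n.
have xx : 0 < dotv x x by rewrite lt_def dotv_eq0 x0 dotv_ge0.
exists ((Num.sqrt (dotv x x))^-1 *: x); first exact: rpredZ.
rewrite dotvZl dotvZr mulrA -expr2 exprVn sqr_sqrtr ?dotv_ge0 // mulVf //.
exact: lt0r_neq0.
Qed.

(** On the sphere of [E], the form given by [w] is the one given by the
    projection of [w], which can be rotated to a multiple of [e]. *)
Lemma moment_sqproj j e w : e \in E -> dotv e e = 1 ->
  M j.*2 w = sqproj E w ^+ j * M j.*2 e.
Proof.
move=> eE e1; pose b := Num.sqrt (sqproj E w).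
have b2 : b ^+ 2 = sqproj E w by rewrite sqr_sqrtr ?sqproj_ge0.
have -> : M j.*2 w = M j.*2 (w *m projmx E).
  apply: eq_Rintegral => x /set_mem[_ /= xE].
  by rewrite -{1}(projmx_id xE) dotv_mulmxl trmx_projmx.
rewrite (@moment_rotate _ _ (b *: e)) ?mem_projmx ?rpredZ //; last first.
  by rewrite -sqprojE dotvZl dotvZr e1 mulr1 -expr2 b2.
rewrite -b2 -exprM mul2n /M -(bmf_RintegralZ mD sgD); last exact/bmfX/bmf_dotv.
by apply: eq_Rintegral => x _; rewrite dotvZr exprMn.
Qed.

End sphere_moments.

Lemma horner_inj (R : numDomainType) (p q : {poly R}) :
  (forall x, p.[x] = q.[x]) -> p = q.
Proof.
move=> pq; apply/eqP; rewrite -subr_eq0; apply/negPn/negP => nz.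
suff : (size [seq i%:R : R | i <- iota 0 (size (p - q)%R)] < size (p - q)%R)%N.
  by rewrite size_map size_iota ltnn.
apply: max_poly_roots nz _ _.
  by apply/allP => x _; rewrite rootE !hornerE pq subrr.
by rewrite map_inj_uniq ?iota_uniq // => i j /eqP; rewrite eqr_nat => /eqP.
Qed.

(** The coefficients of degree 0 and 1 are there for the induction. *)
Lemma coef_quadratic_exp (R : comNzRingType) (b c : R) k :
  let p := (1 + b *: 'X + c *: 'X^2) ^+ k in
  [/\ p`_0 = 1, p`_1 = k%:R * b & p`_2 = 'C(k, 2)%:R * b ^+ 2 + k%:R * c].
Proof.
elim: k => [|k /= [IH0 IH1 IH2]] /=.
  by rewrite expr0 !coefC /= bin0n !mul0r addr0.
have c0 : (1 + b *: 'X + c *: 'X^2)`_0 = 1.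
  by rewrite !coefD !coefZ coefX coefXn coef1 /= !mulr0 !addr0.
have c1 : (1 + b *: 'X + c *: 'X^2)`_1 = b.
  by rewrite !coefD !coefZ coefX coefXn coef1 /= mulr0 mulr1 add0r addr0.
have c2 : (1 + b *: 'X + c *: 'X^2)`_2 = c.
  by rewrite !coefD !coefZ coefX coefXn coef1 /= mulr0 mulr1 !add0r.
rewrite exprS !coefM !big_ord_recl !big_ord0 /= /bump /= !c0 c1 c2 IH0 IH1 IH2.
rewrite binS bin1 natrD -[k.+1%:R]natr1; split; ring.
Qed.

Lemma natr_bin2 (R : comNzRingType) k :
  2 * ('C(k.+1, 2))%:R = k.+1%:R * k%:R :> R.
Proof.
elim: k => [|k IH]; first by rewrite bin_small // !mulr0.
by rewrite binS bin1 natrD mulrDr IH -[k.+2%:R]natr1 -[k.+1%:R]natr1; ring.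
Qed.

(** The even moments of a coordinate on the unit sphere of R^m. *)
Fixpoint sphere_moment (R : realType) (m j : nat) : R :=
  if j is i.+1 then i.*2.+1%:R / (m + i.*2)%:R * sphere_moment R m i else 1.

Lemma sphere_moment_gt0 (R : realType) m j : (0 < m)%N -> 0 < sphere_moment R m j.
Proof.
move=> m0; elim: j => [|j IH] //=.
by rewrite mulr_gt0 // divr_gt0 // ltr0n // addn_gt0 m0.
Qed.

Section sphere_moment_recursion.
Variables (R : realType) (n m : nat) (E : linsub R n).
Variable sg : probability (borel_space 'rV[R]_n) R.
Hypotheses (m0 : (0 < m)%N) (hE : grassmannian R n m E)
  (hsg : is_haar_sphere_in E sg).

Let D : set (borel_space 'rV[R]_n) := sphere_in E.
Let mD : measurable D. Proof. exact: measurable_sphere_in. Qed.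
Let sgD : sg D = 1%E. Proof. by case: hsg. Qed.
Let M j w := \int[sg]_(x in D) dotv x w ^+ j.

(** Compare the coefficients of [t ^+ 2] in [moment_sqproj] applied to
    [e + t *: w], both sides of which are polynomials in [t]. *)
Lemma moment_mixed j (e w : 'rV[R]_n) : e \in E -> dotv e e = 1 ->
  'C(j.+1.*2, 2)%:R * \int[sg]_(x in D) (dotv x e ^+ j.*2 * dotv x w ^+ 2) =
  ('C(j.+1, 2)%:R * (2 * dotv e w) ^+ 2 + j.+1%:R * sqproj E w) * M j.+1.*2 e.
Proof.
move=> eE e1; pose N := j.+1.*2.
pose pL : {poly R} := \poly_(l < N.+1)
  ('C(N, l)%:R * \int[sg]_(x in D) (dotv x e ^+ (N - l) * dotv x w ^+ l)).
pose pR : {poly R} :=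
  M N e *: (1 + (2 * dotv e w) *: 'X + sqproj E w *: 'X^2) ^+ j.+1.
have bmfw k l : bounded_mfun D
    (fun x : borel_space 'rV[R]_n => dotv x e ^+ k * dotv x w ^+ l).
  by apply: bmfM; apply: bmfX; exact: bmf_dotv.
have pLR : pL = pR.
  apply: horner_inj => t; rewrite /pR hornerZ horner_exp !hornerD !hornerZ.
  rewrite hornerX hornerXn -[1]polyC1 hornerC [RHS]mulrC.
  have -> : 1 + 2 * dotv e w * t + sqproj E w * t ^+ 2 = sqproj E (e + t *: w).
    rewrite /sqproj mulmxDl -scalemxAl (projmx_id eE).
    rewrite !(dotvDl, dotvDr, dotvZl, dotvZr). rewrite e1.
    rewrite (dotv_mulmxl w e) trmx_projmx (projmx_id eE) (dotvC w e); ring.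
  rewrite -(moment_sqproj hsg j.+1 (e + t *: w) eE e1) horner_poly.
  transitivity (\int[sg]_(x in D) (\sum_(l < N.+1)
      t ^+ l * 'C(N, l)%:R * (dotv x e ^+ (N - l) * dotv x w ^+ l))).
    rewrite (bmf_Rintegral_sum mD sgD) => [|l]; last by exact: bmfZ.
    apply: eq_bigr => l _; rewrite (bmf_RintegralZ mD sgD) //; ring.
  apply: eq_Rintegral => x _; rewrite dotvDr dotvZr exprDn; apply: eq_bigr => l _.
  by rewrite exprMn -mulr_natl; ring.
have := congr1 (fun p : {poly R} => p`_2) pLR; rewrite /= coefZ.
have [_ _ ->] := coef_quadratic_exp (2 * dotv e w) (sqproj E w) j.+1.
by rewrite coef_poly /N doubleS /= subn2 /= mulrC => ->; rewrite mulrC.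
Qed.

(** Sum [moment_mixed] over an orthonormal basis of the whole space: on the left
    the squares add up to 1 on the sphere, on the right the projections add up to
    the dimension of [E]. *)
Lemma moment_rec j (e : 'rV[R]_n) : e \in E -> dotv e e = 1 ->
  j.*2.+1%:R * M j.*2 e = (m + j.*2)%:R * M j.+1.*2 e.
Proof.
move=> eE e1.
have bmfw l i : bounded_mfun D (fun x : borel_space 'rV[R]_n =>
    dotv x e ^+ l * dotv x (basis_vec R i) ^+ 2).
  by apply: bmfM; apply: bmfX; exact: bmf_dotv.
have sumx (x : 'rV[R]_n) : \sum_i dotv x (basis_vec R i) ^+ 2 = dotv x x.
  by apply: eq_bigr => i _; rewrite dotv_basis_vec expr2.
have Me : M j.*2 e = \sum_i \int[sg]_(x in D)
    (dotv x e ^+ j.*2 * dotv x (basis_vec R i) ^+ 2).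
  rewrite -(bmf_Rintegral_sum mD sgD) //; apply: eq_Rintegral => x /set_mem[/= x1 _].
  by rewrite -mulr_sumr sumx x1 mulr1.
have : 'C(j.+1.*2, 2)%:R * M j.*2 e =
    ('C(j.+1, 2)%:R * 4 + j.+1%:R * m%:R) * M j.+1.*2 e.
  rewrite Me mulr_sumr; under eq_bigr do rewrite moment_mixed //.
  rewrite -mulr_suml big_split /= -!mulr_sumr (sum_sqproj_basis_vec hE).
  congr ((_ * _ + _) * _); under eq_bigr do rewrite exprMn.
  by rewrite -mulr_sumr sumx e1 mulr1 -natrX.
have b1 := natr_bin2 R j; have b2 := natr_bin2 R j.*2.+1.
rewrite -doubleS in b2; move: b1 b2; rewrite natrD.
set x := 'C(_, _)%:R; set y := 'C(_, _)%:R.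
have -> : j.*2.+1%:R = 2 * j%:R + 1 :> R by rewrite -[LHS]natr1 -mul2n natrM.
have -> : j.+1.*2%:R = 2 * (j%:R + 1) :> R by rewrite -mul2n natrM natr1.
have -> : j.*2%:R = 2 * j%:R :> R by rewrite -mul2n natrM.
rewrite -[j.+1%:R]natr1; set jj : R := j%:R; move=> xE yE xy.
have j1 : jj + 1 != 0 by rewrite natr1 pnatr_eq0.
apply: (mulfI j1); rewrite mulrA.
have -> : (jj + 1) * (2 * jj + 1) = y by lra.
by rewrite xy mulrA; congr (_ * _); lra.
Qed.

Lemma moment_sphereE j (w : 'rV[R]_n) :
  M j.*2 w = sphere_moment R m j * sqproj E w ^+ j.
Proof.
have [e eE e1] := exists_unit_in m0 hE.
rewrite /M (moment_sqproj hsg j w eE e1) mulrC; congr (_ * _).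
elim: j => [|j IH].
  by under eq_Rintegral do rewrite expr0; rewrite (Rintegral_prob_cst mD sgD).
have mj : (m + j.*2)%:R != 0 :> R by rewrite pnatr_eq0 -lt0n addn_gt0 m0.
have rec := moment_rec j eE e1; rewrite /M /D IH in rec.
by apply: (mulfI mj); rewrite -rec /= mulrA mulrCA divff // mulr1.
Qed.

End sphere_moment_recursion.

Section radon_range_polynomial.
Variables (R : realType) (n m : nat).
Variable sigma : linsub R n -> probability (borel_space 'rV[R]_n) R.
Hypotheses (m0 : (0 < m)%N)
  (hsigma : forall E, grassmannian R n m E -> is_haar_sphere_in E (sigma E)).

(** Each monomial is divided by the corresponding moment of the sphere. *)
Lemma radon_range_horner (p : {poly R}) (x : 'rV[R]_n) :
  radon_range sigma m (fun E => p.[sqproj E x]).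
Proof.
pose a j := p`_j / sphere_moment R m j.
exists (fun y => \sum_(j < size p) a j * dotv y x ^+ j.*2).
  apply: continuous_subspaceT => y.
  have hx : is_Cr 0 setT (fun y => dotv y x).
    by split => // z _; exact: (@dotvl_continuous R n x z).
  have hX k : is_Cr 0 setT (fun y => dotv y x ^+ k).
    elim: k => [|k IH].
      apply: eq_is_Cr (is_Cr_cst openT 0 1) => [|z _]; first exact: openT.
      by rewrite expr0.
    apply: eq_is_Cr (is_CrM openT hx IH) => [|z _]; first exact: openT.
    by rewrite exprS.
  have := is_Cr_sum openT (index_enum 'I_(size p))
    (fun j => is_CrM openT (is_Cr_cst openT 0 (a j)) (hX j.*2)).
  by move=> /is_Cr_continuous; apply.
move=> E hE; have sE := hsigma hE.
have mD : measurable (sphere_in E : set (borel_space 'rV[R]_n)).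
  exact: measurable_sphere_in.
have sgD : sigma E (sphere_in E) = 1%E by case: sE.
have bmfw k : bounded_mfun (sphere_in E : set (borel_space 'rV[R]_n))
    (fun y : borel_space 'rV[R]_n => dotv y x ^+ k).
  by apply: bmfX; exact: bmf_dotv.
rewrite /radon (bmf_Rintegral_sum mD sgD) => [|j]; last exact: bmfZ.
rewrite horner_coef; apply: eq_bigr => j _.
rewrite (bmf_RintegralZ mD sgD) // (moment_sphereE m0 hE sE) /a mulrA divfK //.
exact/lt0r_neq0/sphere_moment_gt0.
Qed.

End radon_range_polynomial.

(** * The test function and its averages *)

Section quadratic_test_function.
Variables (R : realType) (n : nat) (xi : 'rV[R]_n) (t k : R).

(** The factor is such that an average of [(sqproj E xi - t) ^+ 2] of at least
    [2 * k] becomes an average of at least 1. *)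
Definition quad_test (E : linsub R n) : R := k^-1 * ((sqproj E xi - t) ^+ 2 - k).

Lemma quad_test_continuous : continuous quad_test.
Proof.
move=> E; have cQ := @sqproj_continuous R n xi E.
have cd : (fun F : linsub R n => sqproj F xi - t) @ E --> sqproj E xi - t.
  by apply: cvgB cQ _; exact: cvg_cst.
have cs := cvgM (cvg_cst k^-1) (cvgB (cvgM cd cd) (cvg_cst k)).
exact: cs.
Qed.

Lemma quad_test_smooth m : smooth_on_grassmannian m quad_test.
Proof.
move=> r; have oU := @open_row_free R m n.
have hQ := is_Cr_sqproj_rowspan m r xi.
have hQt := is_CrD oU hQ (is_Cr_cst oU r (- t)).
have := is_CrM oU (is_Cr_cst oU r k^-1)
  (is_CrD oU (is_CrM oU hQt hQt) (is_Cr_cst oU r (- k))).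
by apply: eq_is_Cr => // A Af.
Qed.

Lemma quad_test_rotate u E : stabilizer xi u ->
  quad_test (rotate u E) = quad_test E.
Proof. by move=> xu; rewrite /quad_test sqproj_rotate_fix. Qed.

Lemma Rintegral_quad_test_ge1 (m : nat) (theta : 'rV[R]_n)
    (mu : probability (borel_space (linsub R n)) R) :
  sphere R n theta -> sphere R n xi -> (1 < m < n)%N -> 0 <= t < 1 ->
  is_haar_grassmannian_through m theta mu ->
  0 < k ->
  2 * k <= ((1 - t) / 2) ^+ 2 / (n%:R ^+ 2 * (n%:R + 2)) ->
  1 <= \int[mu]_(E in grassmannian_through m theta) quad_test E.
Proof.
move=> th1 xi1 hm ht hmu k0 hk.
have mD := measurable_grassmannian_through m theta.
have muD : mu (grassmannian_through m theta) = 1%E by case: hmu.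
set D : set (borel_space (linsub R n)) := grassmannian_through m theta in mD muD *.
have hq : bounded_mfun D (fun E : borel_space (linsub R n) => (sqproj E xi - t) ^+ 2).
  by apply/bmfX/bmfB; [exact: bmf_sqproj|exact: bmf_cst].
rewrite /quad_test (bmf_RintegralZ mD muD); last by apply: bmfB => //; exact: bmf_cst.
rewrite (bmf_RintegralB mD muD) //; last exact: bmf_cst.
rewrite (Rintegral_prob_cst mD muD) mulrC ler_pdivlMr // mul1r.
have := second_moment_lower th1 xi1 hm ht hmu; rewrite -/D; lra.
Qed.

End quadratic_test_function.

Theorem theorem1p2 (R : realType) (n k : nat)
  (hn : (4 <= n)%N) (hk : (2 <= k <= n - 2)%N)
  (sigma : linsub R n -> probability (borel_space 'rV[R]_n) R)
  (hsigma : forall E, grassmannian R n (n - k) E ->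
     is_haar_sphere_in E (sigma E))
  (eta : probability (borel_space (linsub R n)) R)
  (heta : is_haar_grassmannian (n - k) eta)
  (nu nu' : 'rV[R]_n -> probability (borel_space (linsub R n)) R)
  (hnu : forall theta, sphere R n theta ->
     is_haar_grassmannian_through (n - k) theta (nu theta))
  (hnu' : forall theta, sphere R n theta ->
     is_haar_grassmannian_through k theta (nu' theta))
  (xi0 : 'rV[R]_n) (hxi0 : sphere R n xi0) :
  exists g : linsub R n -> R,
    [/\ {within grassmannian R n (n - k), continuous g},
        smooth_on_grassmannian (n - k) g,
        invariant_on_grassmannian (n - k) (stabilizer xi0) g,
        forall theta, sphere R n theta -> 1 <= dual_radon nu (n - k) g theta &
        forall theta, sphere R n theta ->
          1 <= dual_radon nu' k (perp_transform g) theta] /\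
    exists h : linsub R n -> R,
      [/\ radon_range sigma (n - k) h,
          forall E, grassmannian R n (n - k) E -> 0 <= h E,
          invariant_on_grassmannian (n - k) (stabilizer xi0) h &
          \int[eta]_(E in grassmannian R n (n - k)) (g E * h E) < 0].
Proof.
case/andP: hk => k2 kn.
have n0 : (0 < n)%N by apply: leq_trans hn.
have kln : (k <= n)%N by apply: leq_trans kn _; exact: leq_subr.
have hm : (1 < n - k < n)%N by lia.
have hk : (1 < k < n)%N by lia.
set m := (n - k)%N in hm *.
have nR : 0 < (n%:R : R) by rewrite ltr0n.
pose t : R := m%:R / n%:R; pose s : R := k%:R / n%:R.
have st : s = 1 - t.
  by rewrite /s /t /m natrB //; field; rewrite gt_eqF.
have t01 : 0 < t < 1.
  have m0 : (0 < m)%N by lia.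
  by rewrite divr_gt0 ?ltr0n //= ltr_pdivrMr // mul1r ltr_nat; case/andP: hm.
have [t0 t1] := andP t01.
pose K : R := n%:R ^+ 2 * (n%:R + 2).
have K1 : 1 <= K.
  have : 1 <= (n%:R : R) by rewrite ler1n.
  by rewrite /K; move: (n%:R : R) => x x1; nra.
have K0 : 0 < K by rewrite (lt_le_trans _ K1).
(* The product of two numbers at most 1 is below both bounds of
   [second_moment_lower], for [t] and for [s]. *)
pose kappa := ((1 - t) / 2) ^+ 2 * ((1 - s) / 2) ^+ 2 / K / 2.
have sq (x : R) : 0 < x < 1 -> 0 < ((1 - x) / 2) ^+ 2 <= 1.
  by move=> /andP[x0 x1]; rewrite exprn_gt0 ?expr_le1 //; lra.
have s01 : 0 < s < 1 by rewrite st; lra.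
have /andP[A0 A1] := sq t t01; have /andP[B0 B1] := sq s s01.
have kap0 : 0 < kappa by rewrite !divr_gt0 // mulr_gt0.
have kapt : 2 * kappa <= ((1 - t) / 2) ^+ 2 / K.
  rewrite /kappa mulrC divfK // ler_pM2r ?invr_gt0 //.
  by rewrite ler_piMr // ltW.
have kaps : 2 * kappa <= ((1 - s) / 2) ^+ 2 / K.
  rewrite /kappa mulrC divfK // ler_pM2r ?invr_gt0 //.
  by rewrite ler_piMl // ltW.
have kap1 : kappa < 1.
  have : ((1 - t) / 2) ^+ 2 / K <= 1 by rewrite ler_pdivrMr // mul1r (le_trans A1).
  by lra.
exists (quad_test xi0 t kappa); split.
  split.
  - by apply: continuous_subspaceT; exact: quad_test_continuous.
  - exact: quad_test_smooth.
  - by move=> u E xu _; exact: quad_test_rotate.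
  - move=> theta th1; rewrite /dual_radon.
    apply: Rintegral_quad_test_ge1 kap0 kapt => //; last exact: hnu.
    by rewrite ltW.
  - move=> theta th1; rewrite /dual_radon.
    under eq_Rintegral => E _.
      rewrite (_ : perp_transform _ E = quad_test xi0 s kappa E); last first.
        by rewrite /perp_transform /quad_test sqproj_orthocomp hxi0 st; ring.
      over.
    apply: Rintegral_quad_test_ge1 kap0 kaps => //; last exact: hnu'.
    by case/andP: s01 => /ltW ->.
have kap01 : 0 < kappa < 1 by rewrite kap0.
have [L hL] := concentration n0 (leq_subr k n) heta hxi0 kap01.
pose p : {poly R} := (1 - ('X - t%:P) ^+ 2) ^+ L.
have pE E : p.[sqproj E xi0] = peak m E xi0 ^+ L.
  by rewrite /p !hornerE /peak.
exists (fun E => p.[sqproj E xi0]); split.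
- by apply: radon_range_horner => //; case/andP: hm => /ltnW.
- by move=> E _; rewrite pE exprn_ge0 // peak_ge0 // leq_subr.
- by move=> u E xu _; rewrite sqproj_rotate_fix.
have mD := @measurable_grassmannian R n m.
have etaD : eta (grassmannian R n m) = 1%E by case: heta.
set D : set (borel_space (linsub R n)) := grassmannian R n m in mD etaD *.
have -> : \int[eta]_(E in D) (quad_test xi0 t kappa E * p.[sqproj E xi0])
   = kappa^-1 *
     \int[eta]_(E in D) (((sqproj E xi0 - t) ^+ 2 - kappa) * peak m E xi0 ^+ L).
  rewrite -(bmf_RintegralZ mD etaD).
    by apply: eq_Rintegral => E _; rewrite pE /quad_test mulrA.
  apply: bmfM.
    apply: bmfB; last exact: bmf_cst.
    by apply/bmfX/bmfB; [exact: bmf_sqproj|exact: bmf_cst].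
  apply/bmfX/bmfB; first exact: bmf_cst.
  by apply/bmfX/bmfB; [exact: bmf_sqproj|exact: bmf_cst].
by rewrite pmulr_rlt0 ?invr_gt0.
Qed.
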